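(* Let $\mathbb A_i=(\mathcal A_i,\mathcal H_i,D_i)$, $i=1,2$, and $\mathbb A=(\mathcal A,\mathcal H_1\oplus\mathcal H_2,D_1\oplus D_2)$ be spectral triples. Then $$d(\mathbb A)=\max\{d(\mathbb A_1),d(\mathbb A_2)\},$$ and the interval $[\underline{\delta}(\mathbb A),\overline{\delta}(\mathbb A)]$ is contained in the interval $$\big[\min\{\underline{\delta}(\mathbb A_1),\underline{\delta}(\mathbb A_2)\},\ \max\{\overline{\delta}(\mathbb A_1),\overline{\delta}(\mathbb A_2)\}\big].$$
   Context: A spectral triple $(\mathcal A,\mathcal H,D)$ consists of a $*$-algebra $\mathcal A$ of bounded operators acting on an infinite-dimensional Hilbert space $\mathcal H$ and a self-adjoint operator $D$ with compact resolvent such that $[D,a]$ is bounded for every $a\in\mathcal A$; it is assumed that $0$ is not an eigenvalue of $D$. For a compact operator $a$, $\mu_n(a)$, $n\ge0$, are the eigenvalues of $|a|$ in non-increasing order with multiplicity, $\mu_a(x)=\mu_n(a)$ for $x\in[n,n+1)$, and $S_a^{\uparrow}(t)=\int_0^t\mu_a(x)\,dx$. $\mathcal L^{1,\infty}$ (resp. $\mathcal L^{1,\infty}_0$) is the set of compact $a$ with $S_a^{\uparrow}(t)/\log t$ bounded (resp. tending to $0$) as $t\to\infty$. The (Hausdorff) dimension of the spectral triple is $d(\mathcal A,\mathcal H,D)=\inf\{d>0:|D|^{-d}\in\mathcal L^{1,\infty}_0\}=\sup\{d>0:|D|^{-d}\notin\mathcal L^{1,\infty}\}$ (with $\inf\emptyset=\infty$,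 $\sup\emptyset=0$). With $f(t)=-\log\mu_{|D|^{-1}}(e^t)$, $t\in\mathbb R$, the minimal and maximal dimensions of the spectral triple are (conventions $1/0=\infty$, $1/\infty=0$; the limits in $h$ exist) $$\underline{\delta}(\mathcal A,\mathcal H,D)=\Big(\lim_{h\to\infty}\limsup_{t\to\infty}\tfrac{f(t+h)-f(t)}{h}\Big)^{-1},\qquad \overline{\delta}(\mathcal A,\mathcal H,D)=\Big(\lim_{h\to\infty}\liminf_{t\to\infty}\tfrac{f(t+h)-f(t)}{h}\Big)^{-1}.$$ *)

(* Defs.v *)
From HB Require Import structures.
From mathcomp Require Import all_boot all_order all_algebra.
From mathcomp Require Import complex ring.
From mathcomp Require Import all_classical all_reals all_analysis.

Set Implicit Arguments.
Unset Strict Implicit.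
Unset Printing Implicit Defensive.

Import Order.TTheory GRing.Theory Num.Theory.
Import numFieldNormedType.Exports.

Local Open Scope classical_set_scope.
Local Open Scope complex_scope.
Local Open Scope ring_scope.

(* The inner product is linear in its first argument; its positivity and
   definiteness follow from inner_normE. *)
HB.mixin Record CompleteNormedModule_isHilbert (R : realType) H
    & CompleteNormedModule R[i] H := {
  inner : H -> H -> R[i];
  inner_linearl : forall (y : H) (a : R[i]) (u v : H),
    inner (a *: u + v) y = a * inner u y + inner v y;
  innerC : forall x y : H, inner x y = (inner y x)^*;
  inner_normE : forall x : H, `|x| ^+ 2 = inner x x
}.

#[short(type="hilbertType")]
HB.structure Definition Hilbert (R : realType) :=
  {H of CompleteNormedModule R[i] H & CompleteNormedModule_isHilbert R H}.

(* H1 * H2 already carries the sup norm, hence an alias. *)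
Definition hsum (R : realType) (H1 H2 : hilbertType R) : Type := (H1 * H2)%type.

Section HilbertSum.
Context {R : realType} (H1 H2 : hilbertType R).
Local Notation H := (hsum H1 H2).

HB.instance Definition _ := GRing.Lmodule.copy H (H1 * H2)%type.

Definition hsum_norm (x : H) : R[i] := sqrtC (`|x.1| ^+ 2 + `|x.2| ^+ 2).

Let hsum_norm_ge0 x : 0 <= hsum_norm x.
Proof. by rewrite sqrtC_ge0 addr_ge0// exprn_ge0. Qed.

Let hsum_normsq x : hsum_norm x ^+ 2 = `|x.1| ^+ 2 + `|x.2| ^+ 2.
Proof. by rewrite sqrtCK. Qed.

Let ler_hsum_normD x y : hsum_norm (x + y) <= hsum_norm x + hsum_norm y.
Proof.
have sq_le (u v : R[i]) : 0 <= u -> 0 <= v -> (u <= v) = (u ^+ 2 <= v ^+ 2).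
  by move=> u0 v0; rewrite ler_pXn2r ?nnegrE.
rewrite sq_le ?addr_ge0// sqrrD !hsum_normsq /=.
pose a := `|x.1|; pose b := `|x.2|; pose c := `|y.1|; pose d := `|y.2|.
have [a0 b0 c0 d0] : [/\ 0 <= a, 0 <= b, 0 <= c & 0 <= d] by rewrite !normr_ge0.
have cs : a * c + b * d <= hsum_norm x * hsum_norm y.
  have -> : hsum_norm x * hsum_norm y
          = sqrtC ((a ^+ 2 + b ^+ 2) * (c ^+ 2 + d ^+ 2)).
    by rewrite sqrtCM ?nnegrE ?addr_ge0 ?exprn_ge0.
  rewrite sq_le ?sqrtC_ge0 ?mulr_ge0 ?addr_ge0 ?mulr_ge0 ?exprn_ge0// sqrtCK.
  rewrite -subr_ge0.
  have -> : (a ^+ 2 + b ^+ 2) * (c ^+ 2 + d ^+ 2) - (a * c + b * d) ^+ 2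
          = (a * d - b * c) ^+ 2 by ring.
  by rewrite real_exprn_even_ge0// rpredB// ger0_real// mulr_ge0.
apply: (@le_trans _ _ ((a + c) ^+ 2 + (b + d) ^+ 2)).
  by rewrite lerD// ler_pXn2r ?nnegrE ?addr_ge0// ler_normD.
have -> : (a + c) ^+ 2 + (b + d) ^+ 2
        = a ^+ 2 + b ^+ 2 + (a * c + b * d) *+ 2 + (c ^+ 2 + d ^+ 2) by ring.
by rewrite lerD2r lerD2l lerMn2r cs orbT.
Qed.

Let hsum_normZ (l : R[i]) x : hsum_norm (l *: x) = `|l| * hsum_norm x.
Proof.
rewrite /hsum_norm/= !normrZ !exprMn -mulrDr sqrtCM ?nnegrE ?exprn_ge0//.
by rewrite sqrCK.
Qed.

Let hsum_norm0_eq0 x : hsum_norm x = 0 -> x = 0.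
Proof.
move/eqP; rewrite sqrtC_eq0 paddr_eq0 ?exprn_ge0// !expf_eq0/= !normr_eq0.
by case: x => u v /= /andP[/eqP -> /eqP ->].
Qed.

HB.instance Definition _ := Lmodule_isNormed.Build R[i] H
  ler_hsum_normD hsum_normZ hsum_norm0_eq0.

Let le_hsum_norm1 (x : H) : `|x.1| <= `|x|.
Proof.
rewrite -(@ler_pXn2r _ 2)// ?nnegrE//; rewrite [leRHS]hsum_normsq.
by rewrite lerDl exprn_ge0.
Qed.

Let le_hsum_norm2 (x : H) : `|x.2| <= `|x|.
Proof.
rewrite -(@ler_pXn2r _ 2)// ?nnegrE//; rewrite [leRHS]hsum_normsq.
by rewrite lerDr exprn_ge0.
Qed.

Let hsum_norm_le (x : H) : `|x| <= `|x.1| + `|x.2|.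
Proof.
rewrite -(@ler_pXn2r _ 2)// ?nnegrE ?addr_ge0//; rewrite [leLHS]hsum_normsq.
by rewrite sqrrD addrAC lerDl mulrn_wge0 ?mulr_ge0.
Qed.

Let hsum_complete (F : set_system H) : ProperFilter F -> cauchy F -> cvg F.
Proof.
move=> FF /cauchy_ballP Fc.
have c1 : cvg (fst @ F : set_system H1).
  apply: cauchy_cvg; apply/cauchy_ballP => e e0.
  have [/= [A B] [/= FA FB] AB] := Fc e e0.
  exists (fst @` A, fst @` B) => /=.
    split; [apply: filterS FA|apply: filterS FB] => z Az; by exists z.
  move=> [_ _] /= [[u Au <-] [v Bv <-]].
  have /= := AB (u, v) (conj Au Bv).
  by rewrite -!ball_normE/=; apply: le_lt_trans; exact: (le_hsum_norm1 (u - v)).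
have c2 : cvg (snd @ F : set_system H2).
  apply: cauchy_cvg; apply/cauchy_ballP => e e0.
  have [/= [A B] [/= FA FB] AB] := Fc e e0.
  exists (snd @` A, snd @` B) => /=.
    split; [apply: filterS FA|apply: filterS FB] => z Az; by exists z.
  move=> [_ _] /= [[u Au <-] [v Bv <-]].
  have /= := AB (u, v) (conj Au Bv).
  by rewrite -!ball_normE/=; apply: le_lt_trans; exact: (le_hsum_norm2 (u - v)).
move/cvg_ex : c1 => [l1 /cvgrPdist_lt l1P]; move/cvg_ex : c2 => [l2 /cvgrPdist_lt l2P].
apply/cvg_ex; exists ((l1, l2) : H); apply/cvgrPdist_lt => e e0.
have e20 : 0 < e / 2 by rewrite divr_gt0.
near=> z.
rewrite (le_lt_trans (hsum_norm_le _))// (splitr e) ltrD//=.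
  by near: z; exact: l1P.
by near: z; exact: l2P.
Unshelve. all: by end_near. Qed.

HB.instance Definition _ := Uniform_isComplete.Build H hsum_complete.

Definition hsum_inner (x y : H) : R[i] := inner x.1 y.1 + inner x.2 y.2.

Let hsum_inner_linearl (y : H) (a : R[i]) (u v : H) :
  hsum_inner (a *: u + v) y = a * hsum_inner u y + hsum_inner v y.
Proof. by rewrite /hsum_inner/= !inner_linearl mulrDr addrACA. Qed.

Let hsum_innerC (x y : H) : hsum_inner x y = (hsum_inner y x)^*.
Proof. by rewrite /hsum_inner rmorphD/= -!innerC. Qed.

Let hsum_inner_normE (x : H) : `|x| ^+ 2 = hsum_inner x x.
Proof. by rewrite [LHS]hsum_normsq !inner_normE. Qed.

HB.instance Definition _ := CompleteNormedModule_isHilbert.Build R H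
  hsum_inner_linearl hsum_innerC hsum_inner_normE.

End HilbertSum.

Section Operators.
Context {R : realType} {H : hilbertType R}.
Implicit Types (a b T : H -> H) (A : set (H -> H)).

Definition infinite_dimensional : Prop :=
  forall (n : nat) (e : 'I_n -> H),
    exists x : H, forall c : 'I_n -> R[i], x <> \sum_(i < n) c i *: e i.

Definition bounded_op a : Prop :=
  linear a /\ exists M : R[i], forall x, `|a x| <= M * `|x|.

Definition compact_op a : Prop :=
  linear a /\ compact (closure (a @` [set x | `|x| <= 1])).

Definition adjoint_to a b : Prop := forall x y, inner (a x) y = inner x (b y).

Definition positive_op a : Prop := bounded_op a /\ forall x, 0 <= inner (a x) x.

Record star_algebra A : Prop := {
  star_algebra_bounded : forall a, A a -> bounded_op a;
  star_algebra0 : A (fun=> 0);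
  star_algebraD : forall a b, A a -> A b -> A (fun x => a x + b x);
  star_algebraZ : forall (k : R[i]) a, A a -> A (fun x => k *: a x);
  star_algebraM : forall a b, A a -> A b -> A (a \o b);
  star_algebra_adjoint : forall a, A a -> exists2 b, adjoint_to a b & A b
}.

(* |a|, the positive square root of a^* a *)
Definition abs_op a : H -> H :=
  xget (fun=> 0) [set b | positive_op b /\
    exists2 a', adjoint_to a a' & forall x, b (b x) = a' (a x)].

(* mu lists the eigenvalues of the positive compact operator T in
   non-increasing order with multiplicity (padded with zeros if T has finite
   rank): no eigenvector for a nonzero eigenvalue is orthogonal to all e n. *)
Definition eigenvalue_sequence T (mu : nat -> R) : Prop :=
  {homo mu : m n / (m <= n)%N >-> n <= m} /\
  exists e : nat -> H, [/\
    forall m n, inner (e m) (e n) = (m == n)%:R,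
    forall n, T (e n) = (mu n)%:C *: e n &
    forall (l : R) (x : H), l != 0 -> T x = l%:C *: x ->
      (forall n, inner x (e n) = 0) -> x = 0].

Definition singular_value a : nat -> R :=
  xget (fun=> 0) (eigenvalue_sequence (abs_op a)).

(* mu_a on [0, +oo[ *)
Definition mu_fun a (x : R) : R := singular_value a (Num.truncn x).

Definition S_up a (t : R) : R :=
  (\int[lebesgue_measure]_(x in `[0, t]) mu_fun a x)%R.

Definition L1oo0 : set (H -> H) :=
  [set a | compact_op a /\ (S_up a t / ln t) @[t --> +oo] --> (0 : R)].

(* A possibly unbounded operator; the values of opfun outside opdom are
   irrelevant. *)
Record unbounded_op := UnboundedOp {
  opdom : set H;
  opfun :> H -> H;
  opdom0 : opdom 0;
  opdom_lin : forall (k : R[i]) x y, opdom x -> opdom y -> opdom (k *: x + y);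
  opfun_lin : forall (k : R[i]) x y, opdom x -> opdom y ->
    opfun (k *: x + y) = k *: opfun x + opfun y
}.

Implicit Type D : unbounded_op.

(* The left-hand side of the equivalence says that y is in the domain of D^*
   with D^* y = z. *)
Definition self_adjoint D : Prop :=
  dense (opdom D) /\
  forall y z, (forall x, opdom D x -> inner (D x) y = inner x z) <->
              (opdom D y /\ D y = z).

(* T = (D - z)^-1 *)
Definition resolvent D (z : R[i]) T : Prop :=
  [/\ bounded_op T,
      forall x, opdom D (T x) /\ D (T x) - z *: T x = x &
      forall x, opdom D x -> T (D x - z *: x) = x].

Definition compact_resolvent D : Prop :=
  exists z T, resolvent D z T /\ compact_op T.

Definition bounded_commutator D a : Prop :=
  (forall x, opdom D x -> opdom D (a x)) /\
  exists M : R[i], forall x, opdom D x -> `|D (a x) - a (D x)| <= M * `|x|.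

Record spectral_triple A D : Prop := {
  triple_algebra : star_algebra A;
  triple_infinite : infinite_dimensional;
  triple_self_adjoint : self_adjoint D;
  triple_resolvent : compact_resolvent D;
  triple_commutator : forall a, A a -> bounded_commutator D a;
  triple_injective : forall x, opdom D x -> D x = 0 -> x = 0
}.

(* phi(D) for phi bounded on the spectrum of D. If D is self-adjoint with
   compact resolvent then its eigenvectors span a dense subspace, so the bounded
   operator acting by phi(l) on each eigenspace ker (D - l) is unique. *)
Definition functional_calculus D (phi : R -> R) : H -> H :=
  xget (fun=> 0) [set T | bounded_op T /\
    forall (l : R) x, opdom D x -> D x = l%:C *: x -> T x = (phi l)%:C *: x].

(* |D|^(-d) *)
Definition abs_inv_pow D (d : R) : H -> H :=
  functional_calculus D (fun l => `|l| `^ (- d)).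

Definition spectral_dim D : \bar R :=
  ereal_inf [set d%:E | d in [set d : R | 0 < d /\ L1oo0 (abs_inv_pow D d)]].

Definition log_mu D (t : R) : R := - ln (mu_fun (abs_inv_pow D 1) (expR t)).

Definition growth D (h t : R) : \bar R :=
  ((log_mu D (t + h) - log_mu D t) / h)%:E.

Definition min_dim D : \bar R :=
  ((lim (limf_esup (growth D h) (pinfty_nbhs R) @[h --> +oo%R]))^-1)%E.

Definition max_dim D : \bar R :=
  ((lim (limf_einf (growth D h) (pinfty_nbhs R) @[h --> +oo%R]))^-1)%E.

End Operators.

Arguments infinite_dimensional {R} H.
Arguments unbounded_op {R} H.

Section OperatorSum.
Context {R : realType} {H1 H2 : hilbertType R}.
Variables (D1 : unbounded_op H1) (D2 : unbounded_op H2).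

Let dom : set (hsum H1 H2) := [set x | opdom D1 x.1 /\ opdom D2 x.2].

Let op (x : hsum H1 H2) : hsum H1 H2 := (D1 x.1, D2 x.2).

Let dom0 : dom 0.
Proof. by split; exact: opdom0. Qed.

Let dom_lin (k : R[i]) x y : dom x -> dom y -> dom (k *: x + y).
Proof. by move=> [? ?] [? ?]; split; exact: opdom_lin. Qed.

Let op_lin (k : R[i]) x y : dom x -> dom y -> op (k *: x + y) = k *: op x + op y.
Proof. by move=> [? ?] [? ?]; rewrite /op/= !opfun_lin. Qed.

Definition opsum : unbounded_op (hsum H1 H2) := UnboundedOp dom0 dom_lin op_lin.

End OperatorSum.

(* Main.v *)
(** Let [a1], [a2] and [a] be the non-decreasing sequences of absolute values of
the eigenvalues of [D1], [D2] and [D1 (+) D2]. Since [a] is the sorted merge of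
[a1] and [a2], counting orthonormal families of eigenvectors gives
[min (a1 (n/2)) (a2 (n/2)) <= a n <= min (a1 n) (a2 n)], and nothing else about
the merge is needed. The partial sums of [a^(-d)] are therefore comparable to
the sum of those of [a1^(-d)] and [a2^(-d)], whence the statement on the
dimension. For [f = log a], the limit in [h] of the upper difference quotients
is the infimum of the slopes [x] such that [f (t + s) - f t <= x s + C] for
large [t] and all [s >= 0]; by the sandwich, such a bound for both [f1] and [f2]
passes to [f]; the lower quotients are handled in the same way.

That [|D|^(-d)] exists and has singular values [a^(-d)] rests on the spectral
theorem: a self-adjoint injective operator with compact resolvent has a compact
inverse, for which eigenvectors are obtained by maximising the norm on
successive orthocomplements. *)

Require Import Defs.
From mathcomp Require Import all_boot all_order all_algebra.
From mathcomp Require Import complex ring lra.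
From mathcomp Require Import all_classical all_reals all_analysis.
From mathcomp Require Import measurable_realfun.

Set Implicit Arguments.
Unset Strict Implicit.
Unset Printing Implicit Defensive.

Import Order.TTheory GRing.Theory Num.Theory.
Import numFieldNormedType.Exports.

Local Open Scope classical_set_scope.
Local Open Scope complex_scope.
Local Open Scope ring_scope.

(** * Hilbert space preliminaries *)

(** The operators [abs_op], [functional_calculus] and the sequence [singular_value] are picked by
    [xget], hence meaningless until a witness is exhibited, and usable for the last two notions of
    modulus and singular values only once the witness is unique. All are therefore computed on one
    object, an orthonormal basis of eigenvectors of [D]: a bounded operator is determined by its
    values on such a basis. Compactness is given for one resolvent at some complex [z] only, so
    invertibility of [D] itself has to be earned from injectivity and self-adjointness. For the two
    dimensions the obstacle is that the summand realising the minimum in the sandwich changes with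
    [t], so difference quotients of [f] at a fixed [h] cannot be compared with those of [f1] or
    [f2]. Bounds on slopes up to an additive constant survive: in the variable [t = log n], halving
    an index is a shift by [ln 2], and this shift disappears in the constant. *)

Lemma le0_of_small (R : realType) (a M : R) :
  (forall e, 0 < e -> a <= M * e) -> a <= 0.
Proof.
move=> aM; rewrite leNgt; apply/negP => a0.
have K0 : 0 < `|M| + 1 by rewrite ltr_wpDl.
have e0 : 0 < a / (2 * (`|M| + 1)) by rewrite divr_gt0// mulr_gt0.
have h : M * (a / (2 * (`|M| + 1))) <= (`|M| + 1) * (a / (2 * (`|M| + 1))).
  by rewrite ler_pM2r// (le_trans (ler_norm M))// lerDl.
have := le_trans (aM _ e0) h.
have -> : (`|M| + 1) * (a / (2 * (`|M| + 1))) = a / 2.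
  by field; rewrite gt_eqF.
by lra.
Qed.

Section RealNorm.
Context {R : realType} {V : normedZmodType R[i]}.
Implicit Types x y : V.

(** Norms live in [R[i]], whose order is partial; the same number read in [R] gives access to a
    total order, infima and linear arithmetic. *)
Definition rnorm x : R := complex.Re `|x|.

Lemma rnormE x : `|x| = (rnorm x)%:C.
Proof. by rewrite /rnorm RRe_real// ger0_real. Qed.

Lemma rnorm_ge0 x : 0 <= rnorm x.
Proof. by rewrite -lecR -rnormE normr_ge0. Qed.

Lemma rnorm_le x (r : R) : (rnorm x <= r) = (`|x| <= r%:C).
Proof. by rewrite rnormE lecR. Qed.

Lemma rnormD x y : rnorm (x + y) <= rnorm x + rnorm y.
Proof. by rewrite rnorm_le rmorphD/= -!rnormE ler_normD. Qed.

Lemma rnormN x : rnorm (- x) = rnorm x.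
Proof. by rewrite /rnorm normrN. Qed.

Lemma rnormB x y : rnorm (x - y) <= rnorm x + rnorm y.
Proof. by rewrite (le_trans (rnormD _ _))// rnormN. Qed.

Lemma rdistC x y : rnorm (x - y) = rnorm (y - x).
Proof. by rewrite -rnormN opprB. Qed.

Lemma rnorm0 : rnorm 0 = 0.
Proof. by rewrite /rnorm normr0. Qed.

Lemma rnorm_eq0 x : (rnorm x == 0) = (x == 0).
Proof.
by rewrite -[RHS]normr_eq0 rnormE -(inj_eq (@complexI R)).
Qed.

Lemma rnorm0_eq0 x : rnorm x = 0 -> x = 0.
Proof. by move=> /eqP; rewrite rnorm_eq0 => /eqP. Qed.

Lemma rnorm_le0 x : rnorm x <= 0 -> x = 0.
Proof. by move=> x0; apply: rnorm0_eq0; apply/eqP; rewrite eq_le x0 rnorm_ge0. Qed.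

Lemma rnorm_gt0 x : x != 0 -> 0 < rnorm x.
Proof. by move=> x0; rewrite lt_neqAle rnorm_ge0 eq_sym rnorm_eq0 x0. Qed.

Lemma rnorm_small0 x (M : R) : (forall e, 0 < e -> rnorm x <= M * e) -> x = 0.
Proof. by move=> /le0_of_small; exact: rnorm_le0. Qed.

Lemma rdist_abs x y : `|rnorm x - rnorm y| <= rnorm (x - y).
Proof.
have h1 : rnorm x <= rnorm (x - y) + rnorm y.
  by rewrite -[x in leLHS](subrK y) rnormD.
have h2 : rnorm y <= rnorm (x - y) + rnorm x.
  by rewrite rdistC -[y in leLHS](subrK x) rnormD.
by rewrite ler_norml; apply/andP; split; lra.
Qed.

End RealNorm.

Section Scalars.
Context {R : realType}.
Implicit Types (k : R[i]) (r : R).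

Lemma rnormM k l : rnorm (k * l) = rnorm k * rnorm l.
Proof. by apply: complexI; rewrite -rnormE normrM !rnormE rmorphM. Qed.

Lemma rnormX2 k : (rnorm k ^+ 2)%:C = k * k^*.
Proof. by rewrite rmorphXn/= -rnormE normCK. Qed.

Lemma normr_real r : `|r%:C| = `|r|%:C.
Proof. by rewrite normc_def/= expr0n/= addr0 sqrtr_sqr. Qed.

Lemma rnorm_real r : rnorm r%:C = `|r|.
Proof. by rewrite /rnorm normr_real. Qed.

Lemma conj_real r : (r%:C)^* = r%:C.
Proof. by apply/eqP; rewrite eq_complex/= oppr0 !eqxx. Qed.

Lemma rnorm_conj k : rnorm (k^*) = rnorm k.
Proof. by rewrite /rnorm norm_conjC. Qed.

End Scalars.

Section InnerProduct.
Context {R : realType} {H : hilbertType R}.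
Implicit Types (x y z : H) (k : R[i]) (r : R).

Lemma rnormZ k x : rnorm (k *: x) = rnorm k * rnorm x.
Proof. by apply: complexI; rewrite -rnormE normrZ !rnormE rmorphM. Qed.

Lemma innerDl x y z : inner (x + y) z = inner x z + inner y z.
Proof. by rewrite -[x in LHS]scale1r inner_linearl mul1r. Qed.

Lemma inner0l x : inner 0 x = 0.
Proof. by apply: (addIr (inner 0 x)); rewrite -innerDl !add0r. Qed.

Lemma innerZl k x y : inner (k *: x) y = k * inner x y.
Proof. by rewrite -[k *: x]addr0 inner_linearl inner0l addr0. Qed.

Lemma innerNl x y : inner (- x) y = - inner x y.
Proof. by rewrite -scaleN1r innerZl mulN1r. Qed.

Lemma innerBl x y z : inner (x - y) z = inner x z - inner y z.
Proof. by rewrite innerDl innerNl. Qed.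

Lemma innerDr x y z : inner x (y + z) = inner x y + inner x z.
Proof. by rewrite innerC innerDl rmorphD/= -!innerC. Qed.

Lemma innerZr k x y : inner x (k *: y) = k^* * inner x y.
Proof. by rewrite innerC innerZl rmorphM/= -!innerC. Qed.

Lemma inner0r x : inner x 0 = 0.
Proof. by rewrite innerC inner0l rmorph0. Qed.

Lemma innerNr x y : inner x (- y) = - inner x y.
Proof. by rewrite innerC innerNl rmorphN/= -innerC. Qed.

Lemma innerBr x y z : inner x (y - z) = inner x y - inner x z.
Proof. by rewrite innerDr innerNr. Qed.

Lemma inner_suml (I : Type) (s : seq I) (P : pred I) (f : I -> H) y :
  inner (\sum_(i <- s | P i) f i) y = \sum_(i <- s | P i) inner (f i) y.
Proof.
by elim/big_rec2 : _ => [|i a b _ <-]; [exact: inner0l|exact: innerDl].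
Qed.

Lemma inner_sumr (I : Type) (s : seq I) (P : pred I) (f : I -> H) y :
  inner y (\sum_(i <- s | P i) f i) = \sum_(i <- s | P i) inner y (f i).
Proof.
by elim/big_rec2 : _ => [|i a b _ <-]; [exact: inner0r|exact: innerDr].
Qed.

Lemma inner_rnorm x : inner x x = (rnorm x ^+ 2)%:C.
Proof. by rewrite -inner_normE rnormE rmorphXn. Qed.

Lemma rnormZ_ge0 r x : 0 <= r -> rnorm (r%:C *: x) = r * rnorm x.
Proof. by move=> r0; rewrite rnormZ rnorm_real ger0_norm. Qed.

Lemma rnorm_normalize x : x != 0 -> rnorm (((rnorm x)^-1)%:C *: x) = 1.
Proof.
by move=> x0; rewrite rnormZ_ge0 ?invr_ge0 ?rnorm_ge0// mulVf// rnorm_eq0.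
Qed.

Lemma rnormDsqr x y :
  rnorm (x + y) ^+ 2 =
    rnorm x ^+ 2 + rnorm y ^+ 2 + 2 * complex.Re (inner x y).
Proof.
apply: complexI; rewrite -inner_rnorm innerDl !innerDr !inner_rnorm.
rewrite (innerC y x); case: (inner x y) => a b.
by apply/eqP; rewrite eq_complex/=; apply/andP; split; apply/eqP; ring.
Qed.

Lemma inner_eq0 x : (inner x x == 0) = (x == 0).
Proof.
by rewrite inner_rnorm eq_complex/= eqxx andbT sqrf_eq0 rnorm_eq0.
Qed.

Lemma inner_inj x y : (forall z, inner x z = inner y z) -> x = y.
Proof.
move=> xy; apply/eqP; rewrite -subr_eq0 -inner_eq0 innerBl.
by rewrite xy subrr.
Qed.

End InnerProduct.

(** * Finite orthonormal families *)

Definition orthonormal (R : realType) (H : hilbertType R) (I : eqType)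
    (e : I -> H) : Prop :=
  forall i j, inner (e i) (e j) = (i == j)%:R.

Section FiniteOrthonormal.
Context {R : realType} {H : hilbertType R}.
Implicit Types (x y z : H).

Lemma rnorm_orthonormal (I : eqType) (e : I -> H) i :
  orthonormal e -> rnorm (e i) = 1.
Proof.
move=> /(_ i i); rewrite eqxx inner_rnorm => /complexI/eqP.
by rewrite sqrf_eq1 => /orP[/eqP//|/eqP h]; have := rnorm_ge0 (e i); rewrite h; lra.
Qed.

Variables (I : finType) (e : I -> H).
Hypothesis oe : orthonormal e.

Lemma inner_lincomb (c : I -> R[i]) j : inner (\sum_i c i *: e i) (e j) = c j.
Proof.
rewrite inner_suml (bigD1 j)//= innerZl oe eqxx mulr1 big1 ?addr0// => i ij.
by rewrite innerZl oe (negbTE ij) mulr0.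
Qed.

Definition proj x : H := \sum_i inner x (e i) *: e i.

Lemma inner_subproj x j : inner (x - proj x) (e j) = 0.
Proof. by rewrite innerBl inner_lincomb subrr. Qed.

(** Pythagoras: the residual is orthogonal to [proj x], so its squared norm is its inner product
    with [x]. *)
Lemma rnorm_subproj x :
  rnorm (x - proj x) ^+ 2 = rnorm x ^+ 2 - \sum_i rnorm (inner x (e i)) ^+ 2.
Proof.
apply: complexI; rewrite -inner_rnorm rmorphB/= -inner_rnorm rmorph_sum/=.
rewrite innerBr [X in _ - X](_ : _ = 0) ?subr0; last first.
  by rewrite inner_sumr big1// => i _; rewrite innerZr inner_subproj mulr0.
rewrite innerBl inner_suml; congr (_ - _); apply: eq_bigr => i _.
by rewrite innerZl (innerC (e i)) rnormX2.
Qed.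

Lemma bessel x : \sum_i rnorm (inner x (e i)) ^+ 2 <= rnorm x ^+ 2.
Proof. by rewrite -subr_ge0 -rnorm_subproj sqr_ge0. Qed.

End FiniteOrthonormal.

Section Counting.
Context {R : realType} {H : hilbertType R} (I J : finType).

(** Double counting of the sum of [|<f i, g j>|^2]: each row equals [1] because [f i] lies in the
    span of [g], and each column is at most [1] by Bessel. *)
Lemma card_orthonormal_le (f : I -> H) (g : J -> H) :
  orthonormal f -> orthonormal g -> (forall i, f i = proj g (f i)) ->
  (#|I| <= #|J|)%N.
Proof.
move=> of_ og fg; rewrite -(ler_nat R) -!sumr_const.
have -> : \sum_(i in I) (1 : R) = \sum_i \sum_j rnorm (inner (f i) (g j)) ^+ 2.
  apply: eq_bigr => i _; apply/eqP; rewrite -subr_eq0.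
  have := rnorm_subproj og (f i); rewrite -fg subrr rnorm0 expr0n/=.
  by rewrite (rnorm_orthonormal i of_) expr1n => <-.
rewrite exchange_big/=; apply: ler_sum => j _.
rewrite (le_trans _ (_ : rnorm (g j) ^+ 2 <= 1))//; last first.
  by rewrite (rnorm_orthonormal j og) expr1n.
rewrite (le_trans _ (bessel of_ (g j)))//; apply: ler_sum => i _.
by rewrite (innerC (g j)) rnorm_conj.
Qed.

End Counting.

Section Topology.
Context {R : realType} {H : hilbertType R}.
Implicit Types (x y z : H).

Lemma orthonormal_normalize x : x != 0 ->
  orthonormal (fun _ : 'I_1 => ((rnorm x)^-1)%:C *: x).
Proof.
move=> /rnorm_gt0 x0 i j; rewrite !ord1 eqxx innerZl innerZr inner_rnorm.
by rewrite conj_real -!rmorphM/= mulrA -expr2 -exprMn mulVf ?expr1n// gt_eqF.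
Qed.

(** Bessel's inequality for the single unit vector [y / |y|]. *)
Lemma cauchy_schwarz x y : rnorm (inner x y) <= rnorm x * rnorm y.
Proof.
have [->|y0] := eqVneq y 0; first by rewrite inner0r !rnorm0 mulr0.
have := bessel (orthonormal_normalize y0) x; rewrite big_ord1 innerZr conj_real.
rewrite ler_sqr ?nnegrE ?rnorm_ge0// rnormM rnorm_real.
by rewrite ger0_norm ?invr_ge0 ?rnorm_ge0// ler_pdivrMl ?rnorm_gt0// mulrC.
Qed.

Lemma rlip_continuous (f : H -> R) (c : R) :
  (forall x y, `|f x - f y| <= c * rnorm (x - y)) -> continuous f.
Proof.
move=> fc x; apply/cvgrPdist_lt => e e0.
have c0 : 0 < 1 + `|c| by rewrite ltr_pwDl.
have d0 : 0 < (e / (1 + `|c|))%:C :> R[i] by rewrite ltcR divr_gt0.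
have := @nbhsx_ballx _ _ x _ d0; apply: filterS => y.
rewrite -ball_normE/= rnormE ltcR ltr_pdivlMr// => xy.
apply: le_lt_trans (fc x y) _; apply: le_lt_trans xy; rewrite mulrC.
by rewrite ler_wpM2l ?rnorm_ge0// (le_trans (ler_norm c))// lerDr.
Qed.

Lemma closure_le0 (f : H -> R) (S : set H) x : continuous f ->
  (forall w, S w -> f w <= 0) -> closure S x -> f x <= 0.
Proof.
move=> cf Sf; have : closed (f @^-1` [set y | y <= 0]).
  by apply: closed_comp => [y _|]; [exact: cf|exact: closed_le].
by move=> /closure_id {}cf /(closure_subset Sf); rewrite -cf.
Qed.

Lemma closure_rnormP (S : set H) x :
  closure S x <-> forall e : R, 0 < e -> exists2 w, S w & rnorm (x - w) < e.
Proof.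
split=> [Sx e e0|Sx B].
  have e0' : 0 < e%:C :> R[i] by rewrite ltcR.
  have [w [Sw]] := Sx _ (nbhsx_ballx x _ e0').
  by rewrite -ball_normE/= rnormE ltcR; exists w.
rewrite -nbhs_ballE => -[d /= d0 dB].
have dE : d = (complex.Re d)%:C by rewrite RRe_real// gtr0_real.
have [|w Sw xw] := Sx (complex.Re d); first by rewrite -ltcR -dE.
by exists w; split=> //; apply: dB; rewrite -ball_normE/= rnormE dE ltcR.
Qed.

Lemma rcauchy_cvg (u : nat -> H) :
  (forall e : R, 0 < e -> exists N, forall m n, (N <= m)%N -> (N <= n)%N ->
     rnorm (u m - u n) < e) ->
  exists l, forall e : R, 0 < e ->
    exists N, forall n, (N <= n)%N -> rnorm (u n - l) < e.
Proof.
move=> cu; have : cvg (u @ \oo).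
  apply: cauchy_cvg; apply/cauchy_ballP => d d0.
  have dE : d = (complex.Re d)%:C by rewrite RRe_real// gtr0_real.
  have [|N uN] := cu (complex.Re d); first by rewrite -ltcR -dE.
  exists ([set x | exists2 n, (N <= n)%N & x = u n],
          [set x | exists2 n, (N <= n)%N & x = u n]).
    by split; exists N => // n /= Nn; exists n.
  move=> [x y] /= [[m Nm ->] [n Nn ->]].
  by rewrite -ball_normE/= rnormE dE ltcR uN.
move=> /cvg_ex[l /cvgrPdist_lt ul]; exists l => e e0.
have e0' : 0 < e%:C :> R[i] by rewrite ltcR.
have [N _ uN] := ul _ e0'; exists N => n Nn.
by have := uN n Nn; rewrite /= rnormE ltcR rdistC.
Qed.

End Topology.

Section Sequences.
Context {R : realType} {H : hilbertType R}.
Implicit Types (x y z : H).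

Lemma invS_lt (e : R) : 0 < e ->
  exists N, forall n, (N <= n)%N -> n.+1%:R^-1 < e.
Proof.
move=> /ltr_add_invr[N]; rewrite add0r => Ne; exists N => n Nn.
by apply: le_lt_trans Ne; rewrite lef_pV2 ?posrE// ler_nat.
Qed.

(** A cluster point of the image filter, approached at arbitrarily late indices; this replaces the
    extraction of a convergent subsequence. *)
Lemma compact_seq_cluster (K : set H) (w : nat -> H) :
  compact K -> (forall n, K (w n)) ->
  exists p, forall (e : R) N, 0 < e -> exists2 n, (N <= n)%N & rnorm (p - w n) < e.
Proof.
move=> cK Kw; have [|p [_ pw]] := cK (w @ \oo) _; first by exists 0%N => // n _.
exists p => e N e0; have e0' : 0 < e%:C :> R[i] by rewrite ltcR.
have [_ [/= [n Nn <-]]] := pw [set w n | n in [set n | (N <= n)%N]] _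
  (ex_intro2 _ _ N I (fun n Nn => ex_intro2 _ _ n Nn erefl)) (nbhsx_ballx p _ e0').
by rewrite -ball_normE/= rnormE ltcR; exists n.
Qed.

(** Serves sequences whose [n]-th term is chosen with error of order [1 / (n + 1)]: differences are
    then controlled by the sum of two errors. *)
Lemma rcauchy_cvg_invS (u : nat -> H) (M : R) :
  (forall m n, rnorm (u m - u n) <= M * (m.+1%:R^-1 + n.+1%:R^-1)) ->
  exists l, forall e : R, 0 < e ->
    exists N, forall n, (N <= n)%N -> rnorm (u n - l) < e.
Proof.
move=> uM; apply: rcauchy_cvg => e e0.
have M0 : 0 < `|M| + 1 by rewrite ltr_wpDl.
have [N NP] := invS_lt (divr_gt0 e0 (mulr_gt0 (ltr0n R 2) M0)).
exists N => m n Nm Nn; apply: le_lt_trans (uM m n) _.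
have i0 k : 0 < k.+1%:R^-1 :> R by rewrite invr_gt0.
have : (`|M| + 1) * (m.+1%:R^-1 + n.+1%:R^-1) < e.
  have := NP m Nm; have := NP n Nn; rewrite !ltr_pdivlMr ?mulr_gt0//.
  move: (_^-1) (_^-1) (_ + 1) => a b K.
  by nra.
apply: le_lt_trans; rewrite ler_pM2r ?addr_gt0//.
by rewrite (le_trans (ler_norm M))// lerDl.
Qed.

Definition closed_subspace (S : set H) : Prop :=
  [/\ closed S, S 0 & forall k x y, S x -> S y -> S (k *: x + y)].

(* A near-minimiser [v] of the distance to [S] is nearly orthogonal to [S]:
   otherwise moving [v] along a unit vector of [S] would gain too much. *)
Lemma orthogonal_projection (S : set H) y : closed_subspace S ->
  exists2 w, S w & forall u, S u -> inner (y - w) u = 0.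
Proof.
move=> [cS S0 Slin].
pose E := [set rnorm (y - u) ^+ 2 | u in S].
have E0 : has_inf E.
  split; first by exists (rnorm (y - 0) ^+ 2), 0.
  by exists 0 => _ [u _ <-]; exact: sqr_ge0.
(* The tolerance is squared because [E] contains squared distances; the defect of orthogonality is
   its square root. *)
have near n : exists u, S u /\ rnorm (y - u) ^+ 2 < inf E + n.+1%:R^-1 ^+ 2.
  have [|_ [u Su <-] uE] := @inf_adherent _ E (n.+1%:R^-1 ^+ 2) _ E0.
    by rewrite exprn_gt0// invr_gt0.
  by exists u.
have [u uP] := choice near.
have orth n v : S v -> rnorm (inner (y - u n) v) <= n.+1%:R^-1 * rnorm v.
  move=> Sv; have [->|v0] := eqVneq v 0.
    by rewrite inner0r !rnorm0 mulr0.
  have [Su un] := uP n.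
  have := rnorm_subproj (orthonormal_normalize v0) (y - u n).
  rewrite /proj !big_ord1; set v' := _ *: v; set k := inner _ v' => d.
  have Sv' : S v' by rewrite -[v']addr0; exact: Slin.
  (* Since [u n + k v'] is again in [S], the squared distance stays above [inf E], so the gain
     [|k|^2] recorded in [d] is at most the tolerance. *)
  have : inf E <= rnorm (y - u n - k *: v') ^+ 2.
    apply: ge_inf; first by case: E0.
    exists (k *: v' + u n); first exact: Slin.
    by rewrite -addrA -opprD [u n + _]addrC.
  rewrite d => E1; have : rnorm k ^+ 2 <= n.+1%:R^-1 ^+ 2.
    move: E1; rewrite lerBrDr => E1.
    by rewrite -(lerD2l (inf E)) (le_trans E1)// ltW.
  rewrite ler_sqr ?nnegrE ?rnorm_ge0 ?invr_ge0// => kn.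
  have -> : v = (rnorm v)%:C *: v'.
    by rewrite scalerA -rmorphM/= divff ?scale1r// rnorm_eq0.
  rewrite innerZr conj_real rnormM rnormZ rnorm_real mulrCA.
  by rewrite rnorm_normalize// mulr1 ler_wpM2l.
have Su n : S (u n) by case: (uP n).
have diff m n : S (u m - u n).
  by rewrite addrC -scaleN1r; exact: Slin.
have [m n|l ul] := @rcauchy_cvg_invS u 1.
  (* The difference lies in [S] and is itself a difference of two residuals, each nearly orthogonal
     to it. *)
  have : rnorm (u m - u n) ^+ 2 <=
         (m.+1%:R^-1 + n.+1%:R^-1) * rnorm (u m - u n).
    rewrite mulrDl -[leLHS]ger0_norm ?sqr_ge0// -rnorm_real -inner_rnorm.
    rewrite [X in inner X _](_ : _ = (y - u n) - (y - u m)); last first.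
      by rewrite opprB [RHS]addrC addrA subrK.
    rewrite innerBl (le_trans (rnormB _ _))// addrC.
    by rewrite lerD ?orth.
  have [->|d0] := eqVneq (u m - u n) 0.
    by rewrite rnorm0 mul1r addr_ge0// invr_ge0.
  by rewrite expr2 ler_pM2r ?rnorm_gt0// mul1r.
exists l.
  rewrite (_ : S = closure S); last by exact/closure_id.
  apply/closure_rnormP => e e0; have [N /(_ N (leqnn N)) h] := ul e e0.
  by exists (u N) => //; rewrite rdistC.
move=> v Sv; apply: (@rnorm_small0 _ _ _ (2 * rnorm v)) => e e0.
have [N1 N1P] := ul e e0; have [N2 N2P] := invS_lt e0.
pose n := maxn N1 N2.
have -> : y - l = (y - u n) + (u n - l) by rewrite addrA subrK.
rewrite innerDl (le_trans (rnormD _ _))// mulrAC mulr2n mulrDl mul1r mulrDl lerD//.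
  by rewrite (le_trans (orth _ _ Sv))// ler_wpM2r ?rnorm_ge0// ltW// N2P// leq_maxr.
rewrite (le_trans (cauchy_schwarz _ _))// ler_wpM2r ?rnorm_ge0// ltW// N1P//.
by rewrite leq_maxl.
Qed.

End Sequences.

(** * Bounded operators *)

Section BoundedOperators.
Context {R : realType} {H H' : hilbertType R}.
Implicit Types (x y z : H) (T : H -> H').

Lemma linearDE T : linear T -> forall x y, T (x + y) = T x + T y.
Proof. by move=> lT x y; rewrite -[x in LHS]scale1r lT scale1r. Qed.

Lemma linear0E T : linear T -> T 0 = 0.
Proof.
by move=> lT; apply: (addIr (T 0)); rewrite -linearDE// !add0r.
Qed.

Lemma linearZE T : linear T -> forall k x, T (k *: x) = k *: T x.
Proof. by move=> lT k x; rewrite -[k *: x]addr0 lT linear0E// addr0. Qed.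

Lemma linearNE T : linear T -> forall x, T (- x) = - T x.
Proof. by move=> lT x; rewrite -scaleN1r linearZE// scaleN1r. Qed.

Lemma linearBE T : linear T -> forall x y, T (x - y) = T x - T y.
Proof. by move=> lT x y; rewrite linearDE// linearNE. Qed.

Lemma linear_sumE T (I : Type) (s : seq I) (P : pred I) (f : I -> H) :
  linear T -> T (\sum_(i <- s | P i) f i) = \sum_(i <- s | P i) T (f i).
Proof.
move=> lT; elim/big_rec2 : _ => [|i a b _ <-]; first exact: linear0E.
by rewrite linearDE.
Qed.

Lemma rlip_map_continuous T (c : R) :
  (forall x y, rnorm (T x - T y) <= c * rnorm (x - y)) -> continuous T.
Proof.
move=> Tc x; apply/cvgrPdist_lt => e e0.
have eE : e = (complex.Re e)%:C by rewrite RRe_real// gtr0_real.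
have e0' : 0 < complex.Re e by rewrite -ltcR -eE.
have c0 : 0 < 1 + `|c| by rewrite ltr_pwDl.
have d0 : 0 < (complex.Re e / (1 + `|c|))%:C :> R[i] by rewrite ltcR divr_gt0.
have := @nbhsx_ballx _ _ x _ d0; apply: filterS => y.
rewrite -ball_normE/= !rnormE eE !ltcR/= ltr_pdivlMr// => xy.
apply: le_lt_trans (Tc x y) _; apply: le_lt_trans xy; rewrite mulrC.
by rewrite ler_wpM2l ?rnorm_ge0// (le_trans (ler_norm c))// lerDr.
Qed.

Lemma linear_bounded_continuous T (c : R) : linear T ->
  (forall x, rnorm (T x) <= c * rnorm x) -> continuous T.
Proof. by move=> lT Tc; apply: rlip_map_continuous => x y; rewrite -linearBE. Qed.

End BoundedOperators.

Section Operators.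
Context {R : realType} {H : hilbertType R}.
Implicit Types (x y z : H) (T : H -> H).

Lemma bounded_opP T : bounded_op T <->
  linear T /\ exists c : R, 0 <= c /\ forall x, rnorm (T x) <= c * rnorm x.
Proof.
split=> [[lT [M TM]]|[lT [c [_ Tc]]]]; split=> //; last first.
  by exists c%:C => x; rewrite !rnormE -rmorphM lecR.
exists `|complex.Re M|; split=> // x.
have := TM x; rewrite !rnormE; case: M {TM} => a b.
rewrite lecE/= !mulr0 subr0 => /andP[_] /le_trans; apply.
by rewrite ler_wpM2r ?rnorm_ge0// ler_norm.
Qed.

(** A compact set is closed in a Hausdorff space, so the closure of the image of the ball remains
    inside [K]. *)
Lemma compact_op_sub T (K : set H) :
  linear T -> compact K -> (forall x, rnorm x <= 1 -> K (T x)) -> compact_op T.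
Proof.
move=> lT cK TK; split=> //.
have clK : closed K by apply: compact_closed => //; exact: norm_hausdorff.
apply: (subclosed_compact _ cK); first exact: closed_closure.
rewrite (iffLR (closure_id K) clK); apply: closureS => _ [x + <-].
by rewrite /= rnormE lecR => /TK.
Qed.

Lemma compact_op_unit T : compact_op T ->
  compact (closure (T @` [set x | `|x| <= 1])) /\
  forall x, rnorm x <= 1 -> closure (T @` [set x | `|x| <= 1]) (T x).
Proof.
move=> [_ cT]; split=> // x x1; apply: subset_closure; exists x => //=.
by rewrite rnormE lecR.
Qed.

End Operators.

(** * The inverse of a self-adjoint operator with compact resolvent *)

Section Inverse.
Context {R : realType} {H : hilbertType R} (D : unbounded_op H).
Hypothesis saD : self_adjoint D.
Hypothesis crD : compact_resolvent D.
Hypothesis injD : forall x, opdom D x -> D x = 0 -> x = 0.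
Implicit Types (x y z : H).

Lemma self_adjoint_sym x y :
  opdom D x -> opdom D y -> inner (D x) y = inner x (D y).
Proof.
by case: saD => _ sa dx dy; have [_ h] := sa y (D y); exact: h.
Qed.

Lemma opfun0 : D 0 = 0.
Proof.
have d0 := opdom0 D; apply: (addIr (D 0)).
by have := opfun_lin 1 d0 d0; rewrite !scale1r !addr0 add0r => <-.
Qed.

Lemma opfunZ k x : opdom D x -> D (k *: x) = k *: D x.
Proof.
move=> dx; rewrite -[k *: x]addr0 opfun_lin ?opfun0 ?addr0//.
exact: opdom0.
Qed.

Lemma opfunB x y : opdom D x -> opdom D y -> D (x - y) = D x - D y.
Proof.
by move=> dx dy; rewrite addrC -scaleN1r opfun_lin// scaleN1r addrC.
Qed.

Lemma opdomZ k x : opdom D x -> opdom D (k *: x).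
Proof.
by move=> dx; rewrite -[k *: x]addr0; apply: opdom_lin => //; exact: opdom0.
Qed.

Lemma opdomB x y : opdom D x -> opdom D y -> opdom D (x - y).
Proof. by move=> dx dy; rewrite addrC -scaleN1r; exact: opdom_lin. Qed.

(** Otherwise there are unit vectors [w n] with [D (w n)] tending to [0]. As
    [w n = T (D (w n) - z w n)] is the image under the compact resolvent [T] of a bounded sequence,
    a cluster point exists; it is nonzero and killed by [D], against injectivity. *)
Lemma bounded_below : exists2 c : R, 0 < c &
  forall x, opdom D x -> c * rnorm x <= rnorm (D x).
Proof.
apply: contrapT => nc.
have [w wP] : {w : nat -> H & forall n,
    [/\ opdom D (w n), rnorm (w n) = 1 & rnorm (D (w n)) < n.+1%:R^-1]}.
  apply: (@choice _ _ (fun n x =>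
    [/\ opdom D x, rnorm x = 1 & rnorm (D x) < n.+1%:R^-1])).
  move=> n; apply: contrapT => nw; apply: nc.
  exists n.+1%:R^-1; first by rewrite invr_gt0.
  move=> x dx; have [->|x0] := eqVneq x 0.
    by rewrite rnorm0 mulr0 rnorm_ge0.
  rewrite leNgt; apply/negP => xn; apply: nw.
  have nx0 := rnorm_gt0 x0.
  exists (((rnorm x)^-1)%:C *: x); split; first exact: opdomZ.
    by rewrite rnorm_normalize.
  rewrite opfunZ// rnormZ_ge0 ?invr_ge0 ?rnorm_ge0//.
  by rewrite mulrC ltr_pdivrMr.
have [z [T [[/bounded_opP[lT _] _ Tl] /compact_op_unit[cK TK]]]] := crD.
(* A bound for [|D (w n) - z w n|]; dividing by it places the argument of [T] in the unit ball. *)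
pose s : R := 1 + rnorm z; have s0 : 0 < s by rewrite ltr_pwDl// rnorm_ge0.
pose v n := (s^-1)%:C *: w n.
have [|p pv] := compact_seq_cluster (w := v) cK.
  move=> n; have [dw w1 Dw] := wP n.
  rewrite /v -[w n]Tl// -linearZE//; apply: TK.
  rewrite rnormZ_ge0 ?invr_ge0 ?(ltW s0)// ler_pdivrMl// mulr1.
  rewrite (le_trans (rnormB _ _))// rnormZ w1 mulr1 lerD2r.
  by rewrite (le_trans (ltW Dw))// invf_le1// ler1n.
have vn n : rnorm (v n) = s^-1.
  have [_ w1 _] := wP n.
  by rewrite rnormZ w1 rnorm_real mulr1 ger0_norm// invr_ge0 ltW.
have p0 : p != 0.
  apply/eqP => p0; have [|n _] := pv (s^-1) 0%N; first by rewrite invr_gt0.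
  by rewrite p0 sub0r rnormN vn ltxx.
(* Self-adjointness supplies closedness of [D]: both [p] in the domain and [D p = 0] follow once
   [<D u, p> = 0] is checked for all [u] in the domain. *)
have [sa1 sa2] := saD.
have [|dp Dp] := iffLR (sa2 p 0); last by move/eqP : p0; apply; exact: injD.
move=> u du; rewrite inner0r.
apply: (@rnorm_small0 _ _ _ (rnorm (D u) + s^-1 * rnorm u)) => e e0.
have [N NP] := invS_lt e0; have [n Nn pn] := pv e N e0.
rewrite -(subrK (v n) p) innerDr (le_trans (rnormD _ _))// mulrDl lerD//.
  by rewrite (le_trans (cauchy_schwarz _ _))// ler_wpM2l ?rnorm_ge0// ltW.
have [dw w1 Dw] := wP n.
rewrite self_adjoint_sym//; last exact: opdomZ.
rewrite (le_trans (cauchy_schwarz _ _))// -mulrA mulrCA ler_wpM2l ?rnorm_ge0//.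
rewrite /v opfunZ// rnormZ_ge0 ?invr_ge0 ?(ltW s0)//.
by rewrite ler_wpM2l ?invr_ge0 ?(ltW s0)// ltW// (lt_trans Dw)// NP.
Qed.

(** If [D (u n)] tends to [y], the lower bound makes [u] Cauchy, and testing its limit against the
    domain, as self-adjointness allows, shows that [D] sends it to [y]. *)
Lemma closed_range : closed (D @` opdom D).
Proof.
have [c c0 cD] := bounded_below.
apply/closure_id/seteqP; split; first exact: subset_closure.
move=> y /closure_rnormP yD.
have [u uP] : {u : nat -> H & forall n,
    opdom D (u n) /\ rnorm (y - D (u n)) < n.+1%:R^-1}.
  apply: (@choice _ _ (fun n x => opdom D x /\ rnorm (y - D x) < n.+1%:R^-1)).
  move=> n; have [|_ [x dx <-] xn] := yD n.+1%:R^-1.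
    by rewrite invr_gt0.
  by exists x.
have [m n|x ux] := @rcauchy_cvg_invS _ _ u c^-1.
  have [dm um] := uP m; have [dn un] := uP n.
  rewrite ler_pdivlMl// (le_trans (cD _ (opdomB dm dn)))// opfunB//.
  have -> : D (u m) - D (u n) = (y - D (u n)) - (y - D (u m)).
    by rewrite opprB [RHS]addrC addrA subrK.
  by rewrite (le_trans (rnormB _ _))// addrC lerD// ltW.
have [sa1 sa2] := saD.
have [|dx Dx] := iffLR (sa2 x y); last by exists x.
move=> v dv; apply/eqP; rewrite -subr_eq0; apply/eqP.
apply: (@rnorm_small0 _ _ _ (rnorm (D v) + rnorm v)) => e e0.
have [N1 N1P] := ux e e0; have [N2 N2P] := invS_lt e0.
pose n := maxn N1 N2; have [dn un] := uP n.
have -> : inner (D v) x - inner v y =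
    - (inner (D v) (u n - x) + inner v (y - D (u n))).
  by rewrite !innerBr (self_adjoint_sym dv dn); ring.
rewrite rnormN (le_trans (rnormD _ _))// mulrDl lerD//;
  rewrite (le_trans (cauchy_schwarz _ _))// ler_wpM2l ?rnorm_ge0// ltW//.
  by rewrite N1P// leq_maxl.
by rewrite (lt_trans un)// N2P// leq_maxr.
Qed.

(** What is orthogonal to the closed range lies in the kernel of the adjoint, which is [D], and that
    kernel is trivial. *)
Lemma range_full y : exists2 x, opdom D x & D x = y.
Proof.
have [|_ [x dx <-] xP] := @orthogonal_projection _ _ (D @` opdom D) y.
  split; first exact: closed_range.
    by exists 0; [exact: opdom0|exact: opfun0].
  move=> k _ _ [u du <-] [v dv <-]; exists (k *: u + v); first exact: opdom_lin.
  exact: opfun_lin.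
exists x => //; have [sa1 sa2] := saD.
have [|dw Dw] := iffLR (sa2 (y - D x) 0).
  by move=> u du; rewrite inner0r innerC xP ?rmorph0//; exists u.
by apply/esym/eqP; rewrite -subr_eq0; apply/eqP; exact: injD.
Qed.

(** The resolvent identity [B x = T (x - z B x)] transfers compactness from [T] to the inverse [B]:
    on the unit ball the argument of [T] has norm at most [s = 1 + |z| / c], with [c] the lower
    bound of [D]. *)
Lemma compact_inverse : exists B : H -> H,
  compact_op B /\ forall y, opdom D (B y) /\ D (B y) = y.
Proof.
have [B BP] : {B : H -> H & forall y, opdom D (B y) /\ D (B y) = y}.
  apply: (@choice _ _ (fun y x => opdom D x /\ D x = y)).
  by move=> y; have [x dx Dx] := range_full y; exists x.
exists B; split=> //; have [c c0 cD] := bounded_below.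
have lB : linear B.
  move=> k x y; apply/eqP; rewrite -subr_eq0; apply/eqP.
  have [dx Dx] := BP x; have [dy Dy] := BP y; have [dxy Dxy] := BP (k *: x + y).
  have d2 := opdom_lin k dx dy.
  by apply: injD; [exact: opdomB|rewrite opfunB// opfun_lin// Dx Dy Dxy subrr].
have [z [T [[/bounded_opP[lT _] _ Tl] /compact_op_unit[cK TK]]]] := crD.
pose s : R := 1 + rnorm z * c^-1.
have s0 : 0 < s by rewrite ltr_pwDl// mulr_ge0 ?rnorm_ge0// invr_ge0 ltW.
apply: (@compact_op_sub _ _ _
  (( *:%R s%:C) @` closure (T @` [set x | `|x| <= 1]))) => //.
  apply: continuous_compact => //; apply: continuous_subspaceT.
  apply: (@rlip_map_continuous _ _ _ _ s) => x y.
  by rewrite -scalerBr rnormZ_ge0// ltW.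
move=> x x1; have [dx Dx] := BP x.
exists (T ((s^-1)%:C *: (x - z *: B x))); last first.
  rewrite linearZE// scalerA -rmorphM/= divff ?gt_eqF// scale1r.
  by rewrite -{1}Dx Tl.
apply: TK; rewrite rnormZ_ge0 ?invr_ge0 ?(ltW s0)//.
rewrite ler_pdivrMl// mulr1 (le_trans (rnormB _ _))// lerD// rnormZ.
rewrite ler_wpM2l ?rnorm_ge0// -[leRHS]mulr1 ler_pdivlMl//.
by rewrite (le_trans (cD _ dx))// Dx.
Qed.

End Inverse.

(** * Spectral theorem for compact symmetric operators *)

Section CompactSymmetric.
Context {R : realType} {H : hilbertType R} (B : H -> H).
Hypothesis infH : infinite_dimensional H.
Hypothesis cB : compact_op B.
Hypothesis symB : forall x y, inner (B x) y = inner x (B y).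
Hypothesis injB : forall x, B x = 0 -> x = 0.
Implicit Types (x y z v : H) (e : nat -> H).

Lemma rnorm_continuous : continuous (rnorm : H -> R).
Proof.
by apply: (@rlip_continuous _ _ _ 1) => x y; rewrite mul1r rdist_abs.
Qed.

Lemma compact_op_bounded : exists c : R, forall x, rnorm (B x) <= c * rnorm x.
Proof.
have [cK BK] := compact_op_unit cB; have [lB _] := cB.
have [|p Kp pM] := compact_EVT_max _ cK (continuous_subspaceT rnorm_continuous).
  by exists (B 0); apply: BK; rewrite rnorm0.
exists (rnorm p) => x; have [->|x0] := eqVneq x 0.
  by rewrite linear0E// !rnorm0 mulr0.
have nx := rnorm_gt0 x0.
have := pM (B ((rnorm x)^-1%:C *: x)); rewrite inE => /(_ _).
rewrite linearZE// rnormZ_ge0 ?invr_ge0 ?rnorm_ge0//.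
rewrite ler_pdivrMl// mulrC; apply; rewrite -linearZE//; apply: BK.
by rewrite rnorm_normalize.
Qed.

(** Only the first [n] vectors count, so that a finite list read through [nth 0] can take the place
    of [e]. *)
Definition perp e n : set H := [set x | forall i, (i < n)%N -> inner x (e i) = 0].

Section Step.
Variables (e : nat -> H) (n : nat).
Hypothesis oe : forall i j, (i < n)%N -> (j < n)%N ->
  inner (e i) (e j) = (i == j)%:R.
Hypothesis eB : forall i, (i < n)%N -> exists b : R, B (e i) = b%:C *: e i.

Let perpB x : perp e n x -> perp e n (B x).
Proof.
move=> xp i ni; have [b eb] := eB ni.
by rewrite symB eb innerZr xp// mulr0.
Qed.

Let perp_lin k x y : perp e n x -> perp e n y -> perp e n (k *: x + y).
Proof. by move=> px py i ni; rewrite innerDl innerZl px// py// mulr0 addr0. Qed.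

Let perpZ k x : perp e n x -> perp e n (k *: x).
Proof. by move=> px i ni; rewrite innerZl px// mulr0. Qed.

(** Infinite dimension provides a vector outside the span of the first [n]; its residual after
    projection is nonzero. *)
Let perp_neq0 : exists2 x, perp e n x & x != 0.
Proof.
have [x xP] := infH (fun i : 'I_n => e i).
have of_ : orthonormal (fun i : 'I_n => e i) by move=> i j; rewrite oe.
exists (x - proj (fun i : 'I_n => e i) x).
  by move=> i ni; have := inner_subproj of_ x (Ordinal ni).
by apply/eqP => /eqP; rewrite subr_eq0 => /eqP; exact: xP.
Qed.

Let S := B @` [set x | perp e n x /\ rnorm x <= 1].

(* On [S], if [M] is the norm of [B] on the orthocomplement then
   [|B^2 w - M^2 w|^2 <= M^4 (M^2 - |w|^2)], so a limit point of [S] of norm [M]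
   is fixed by [B^2 / M^2]. *)
Let max_eigenvector : exists v, [/\ perp e n v, 0 < rnorm v,
  B (B v) = (rnorm v ^+ 2)%:C *: v &
  forall x, perp e n x -> rnorm (B x) <= rnorm v * rnorm x].
Proof.
have [cK BK] := compact_op_unit cB; have [lB _] := cB.
have [c Bc] := compact_op_bounded.
have cS : compact (closure S).
  apply: (subclosed_compact _ cK); first exact: closed_closure.
  apply: closureS => _ [x [_ x1] <-]; exists x => //=.
  by rewrite rnormE lecR.
have S0 : (closure S) !=set0.
  exists (B 0); apply: subset_closure; exists 0 => //; split; last by rewrite rnorm0.
  by move=> i _; rewrite inner0l.
have [v /set_mem Sv vM] :=
  compact_EVT_max S0 cS (continuous_subspaceT rnorm_continuous).
set M := rnorm v in vM.
have BM x : perp e n x -> rnorm (B x) <= M * rnorm x.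
  move=> px; have [->|x0] := eqVneq x 0.
    by rewrite linear0E// !rnorm0 mulr0.
  have nx := rnorm_gt0 x0.
  have := vM (B ((rnorm x)^-1%:C *: x)); rewrite inE => /(_ _).
  rewrite linearZE// rnormZ_ge0 ?invr_ge0 ?rnorm_ge0//.
  rewrite ler_pdivrMl// mulrC; apply; rewrite -linearZE//; apply: subset_closure.
  exists ((rnorm x)^-1%:C *: x) => //; split; first exact: perpZ.
  by rewrite rnorm_normalize.
have M0 : 0 < M.
  have [x px x0] := perp_neq0.
  have : 0 < rnorm (B x).
    by apply: rnorm_gt0; apply: contra_neq x0 => /injB.
  by move=> /lt_le_trans/(_ (BM x px)); rewrite (pmulr_lgt0 _ (rnorm_gt0 x0)).
have pv : perp e n v.
  move=> i ni; apply: rnorm_le0.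
  apply: (@closure_le0 _ _ (fun x => rnorm (inner x (e i))) _ _ _ _ Sv).
    apply: (@rlip_continuous _ _ _ (rnorm (e i))) => x y.
    rewrite (le_trans (rdist_abs _ _))// -innerBl.
    by rewrite (le_trans (cauchy_schwarz _ _))// mulrC.
  by move=> _ [x [px _] <-]; rewrite perpB// rnorm0.
exists v; split=> //.
pose g w : H := B (B w) - (M ^+ 2)%:C *: w.
have cg : continuous (fun w => rnorm (g w)).
  apply: (@rlip_continuous _ _ _ (`|c| * `|c| + M ^+ 2)) => x y.
  rewrite (le_trans (rdist_abs _ _))//.
  have -> : g x - g y = g (x - y).
    have sw (a1 a2 a3 a4 : H) : a1 - a2 - (a3 - a4) = a1 - a3 - (a2 - a4).
      by rewrite !opprD !opprK addrACA.
    by rewrite /g (linearBE lB x y) (linearBE lB (B x)) scalerBr sw.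
  have c1 z : rnorm (B z) <= `|c| * rnorm z.
    by rewrite (le_trans (Bc z))// ler_wpM2r ?rnorm_ge0// ler_norm.
  rewrite mulrDl (le_trans (rnormB _ _))// lerD//.
    by rewrite (le_trans (c1 _))// -mulrA ler_wpM2l.
  by rewrite rnormZ rnorm_real ger0_norm// sqr_ge0.
(* The inequality [f w <= 0] passes from [S] to its closure by continuity; at [v] the second term
   vanishes, as [|v| = M], and leaves [g v = 0]. *)
pose f w : R := rnorm (g w) * rnorm (g w) - M ^+ 4 * (M ^+ 2 - rnorm w * rnorm w).
have cf : continuous f.
  move=> w; apply: cvgB; first exact: (cvgM (cg w) (cg w)).
  apply: cvgM; first exact: cvg_cst.
  apply: cvgB; first exact: cvg_cst.
  exact: (cvgM (@rnorm_continuous w) (@rnorm_continuous w)).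
have /(closure_le0 cf)/(_ Sv) : forall w, S w -> f w <= 0.
  move=> _ [x [px x1] <-]; rewrite /f.
  (* Commuting [g] with [B] brings the estimate for [w = B x] back to [g x], where [|x| <= 1] can be
     used. *)
  have -> : g (B x) = B (g x).
    by rewrite /g [RHS](linearBE lB) [in RHS](linearZE lB).
  have pg : perp e n (g x).
    by rewrite /g addrC -scaleNr; apply: perp_lin => //; do 2 apply: perpB.
  have h1 : rnorm (B (g x)) ^+ 2 <= M ^+ 2 * rnorm (g x) ^+ 2.
    by rewrite -exprMn ler_sqr ?nnegrE ?mulr_ge0 ?rnorm_ge0 ?(ltW M0)// BM.
  have h2 : rnorm (g x) ^+ 2 =
      rnorm (B (B x)) ^+ 2 + M ^+ 4 * rnorm x ^+ 2 - 2 * M ^+ 2 * rnorm (B x) ^+ 2.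
    rewrite rnormDsqr rnormN rnormZ rnorm_real ger0_norm ?sqr_ge0//.
    rewrite innerNr innerZr conj_real symB inner_rnorm -rmorphM -rmorphN/=.
    by rewrite exprMn -exprM; ring.
  have h3 : rnorm (B (B x)) ^+ 2 <= M ^+ 2 * rnorm (B x) ^+ 2.
    rewrite -exprMn ler_sqr ?nnegrE ?mulr_ge0 ?rnorm_ge0 ?(ltW M0)// BM//.
    exact: perpB.
  have h4 : M ^+ 4 * rnorm x ^+ 2 <= M ^+ 4.
    by rewrite -[leRHS]mulr1 ler_wpM2l ?exprn_ge0 ?(ltW M0)// expr_le1// rnorm_ge0.
  rewrite -!expr2 subr_le0 (le_trans h1)//.
  have -> : M ^+ 4 * (M ^+ 2 - rnorm (B x) ^+ 2) =
            M ^+ 2 * (M ^+ 4 - M ^+ 2 * rnorm (B x) ^+ 2) by ring.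
  by rewrite ler_wpM2l ?sqr_ge0// h2; lra.
rewrite /f -/M -!expr2 subrr mulr0 subr0 => h.
apply/eqP; rewrite -subr_eq0 -rnorm_eq0 -sqrf_eq0 eq_le h.
by rewrite sqr_ge0.
Qed.

(** From [B^2 v = M^2 v], that is [(B - M) (B + M) v = 0]: either [(B + M) v] is a nonzero
    eigenvector for [M], or it vanishes and [v] itself is one for [-M]. *)
Lemma next_eigenvector : exists v (b : R), [/\ rnorm v = 1, perp e n v, b != 0,
  B v = b%:C *: v & forall x, perp e n x -> rnorm (B x) <= `|b| * rnorm x].
Proof.
have [lB _] := cB; have [v [pv v0 BBv vM]] := max_eigenvector.
set M := rnorm v in v0 BBv vM.
have norm_case u (b : R) : perp e n u -> u != 0 -> B u = b%:C *: u -> `|b| = M ->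
    exists v (b : R), [/\ rnorm v = 1, perp e n v, b != 0,
    B v = b%:C *: v & forall x, perp e n x -> rnorm (B x) <= `|b| * rnorm x].
  move=> pu u0 Bu bM; have nu := rnorm_gt0 u0.
  exists ((rnorm u)^-1%:C *: u), b; split; last by rewrite bM.
  - by rewrite rnorm_normalize.
  - exact: perpZ.
  - by rewrite -normr_eq0 bM gt_eqF.
  - by rewrite linearZE// Bu !scalerA mulrC.
have [v'0|v'0] := eqVneq (M%:C *: v + B v) 0.
  apply: (@norm_case v (- M)) => //; last by rewrite normrN gtr0_norm.
    by rewrite -rnorm_eq0 gt_eqF.
  by apply/eqP; rewrite rmorphN/= scaleNr -addr_eq0 addrC v'0.
apply: (norm_case _ M) v'0 _ _; last by rewrite gtr0_norm.
  by apply: perp_lin => //; exact: perpB.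
by rewrite linearDE// linearZE// BBv scalerDr scalerA -rmorphM/= -expr2 addrC.
Qed.

End Step.

(** The values [|b n|] decrease because they are norms of [B] on shrinking orthocomplements. A
    vector [x] orthogonal to all [e n] satisfies [|B x| <= |b n| |x|] for every [n], and compactness
    forces [b n] to become small. *)
Theorem compact_symmetric_eigenbasis : exists (e : nat -> H) (b : nat -> R),
  [/\ orthonormal e, forall n, B (e n) = (b n)%:C *: e n,
      forall n, b n != 0, {homo b : m n / (m <= n)%N >-> `|n| <= `|m|} &
      forall x, (forall n, inner x (e n) = 0) -> x = 0].
Proof.
have [lB _] := cB.
pose good (s : seq H) := (forall i j, (i < size s)%N -> (j < size s)%N ->
    inner s`_i s`_j = (i == j)%:R) /\
  (forall i, (i < size s)%N -> exists b : R, B s`_i = b%:C *: s`_i).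
pose spec (s : seq H) (v : H) := exists b : R,
  [/\ rnorm v = 1, perp (nth 0 s) (size s) v, b != 0, B v = b%:C *: v &
      forall x, perp (nth 0 s) (size s) x -> rnorm (B x) <= `|b| * rnorm x].
have [nxt nxtP] : {nxt : seq H -> H & forall s, good s -> spec s (nxt s)}.
  apply: (@choice _ _ (fun s v => good s -> spec s v)) => s.
  have [[gs1 gs2]|ngs] := pselect (good s).
    by have [v [b bP]] := next_eigenvector gs1 gs2; exists v => _; exists b.
  by exists 0.
(* Each eigenvector depends on all earlier ones, so the recursion runs on the list of those already
   found. *)
pose L n := iter n (fun s => rcons s (nxt s)) [::].
pose e n := nxt (L n).
have LE n : L n = mkseq e n by elim: n => // n ih; rewrite mkseqS -ih.
have LS n : size (L n) = n by rewrite LE size_mkseq.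
have Ln n i : (i < n)%N -> (L n)`_i = e i by move=> ni; rewrite LE nth_mkseq.
have perpL n x : perp (nth 0 (L n)) (size (L n)) x <-> perp e n x.
  by rewrite LS; split=> px i ni; have := px i ni; rewrite Ln.
have goodL n : good (L n).
  elim: n => [|n gn]; first by split.
  have [b [v1 /perpL pv _ Bv _]] := nxtP _ gn.
  have [g1 g2] := gn; rewrite LS in g1 g2.
  rewrite /good LS; split=> [i j ni nj|i ni]; rewrite !Ln//; last first.
    move: ni; rewrite ltnS leq_eqVlt => /orP[/eqP ->|ni]; first by exists b.
    by have := g2 i ni; rewrite Ln.
  move: ni nj; rewrite ltnS leq_eqVlt => /orP[/eqP ->|ni];
    rewrite ltnS leq_eqVlt => /orP[/eqP ->|nj].
  - by rewrite eqxx inner_rnorm v1 expr1n.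
  - by rewrite pv// gtn_eqF.
  - by rewrite innerC pv// rmorph0 ltn_eqF.
  - by have := g1 i j ni nj; rewrite !Ln.
pose eig n (b : R) := [/\ rnorm (e n) = 1, perp e n (e n), b != 0,
  B (e n) = b%:C *: e n & forall x, perp e n x -> rnorm (B x) <= `|b| * rnorm x].
have [b bP] : {b : nat -> R & forall n, eig n (b n)}.
  apply: (@choice _ _ eig) => n.
  have [b [v1 /perpL pv b0 Bv bM]] := nxtP _ (goodL n).
  by exists b; split=> // x /perpL; exact: bM.
have oe : orthonormal e.
  move=> i j; wlog ij : i j / (i <= j)%N.
    move=> h; have [/h//|/ltnW/h h'] := leqP i j.
    by rewrite innerC h' eq_sym; case: (i == j); rewrite ?rmorph1 ?rmorph0.
  have [g1 _] := goodL j.+1; rewrite LS in g1.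
  by have := g1 i j ij (ltnSn j); rewrite !Ln.
have bmono : {homo b : m n / (m <= n)%N >-> `|n| <= `|m|}.
  move=> m n mn; have [_ _ _ _ bm] := bP m; have [n1 _ _ Bn _] := bP n.
  have := bm (e n); rewrite Bn rnormZ rnorm_real n1 !mulr1; apply => i im.
  by rewrite oe gtn_eqF// (leq_trans im).
exists e, b; split=> //; [by move=> n; case: (bP n)..|].
move=> x xe; apply: injB.
have bx n : rnorm (B x) <= `|b n| * rnorm x.
  by have [_ _ _ _ bn] := bP n; apply: bn => i _.
apply: (@rnorm_small0 _ _ _ (rnorm x)) => d d0.
suff [n bn] : exists n, `|b n| < d.
  by rewrite (le_trans (bx n))// mulrC ler_wpM2l ?rnorm_ge0// ltW.
apply: contrapT => nb.
have bd n : d <= `|b n| by rewrite leNgt; apply/negP => bn; apply: nb; exists n.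
have [cK BK] := compact_op_unit cB.
have [|p pP] := compact_seq_cluster (w := fun n => B (e n)) cK.
  by move=> n; apply: BK; rewrite (rnorm_orthonormal n oe).
have d20 : 0 < d / 2 by rewrite divr_gt0.
(* Two indices [m < n] close to the cluster point put [B (e m)] and [B (e n)] at distance below [d],
   whereas orthogonality makes the squared distance [b m ^ 2 + b n ^ 2 >= d ^ 2]. *)
have [m _ pm] := pP (d / 2) 0%N d20.
have [n mn pn] := pP (d / 2) m.+1 d20.
have : rnorm (B (e m) - B (e n)) < d.
  have -> : B (e m) - B (e n) = (p - B (e n)) - (p - B (e m)).
    by rewrite opprB [RHS]addrC addrA subrK.
  by rewrite (le_lt_trans (rnormB _ _))// (splitr d) ltrD.
apply/negP; rewrite -leNgt.
have [_ _ _ Bm _] := bP m; have [_ _ _ Bn _] := bP n.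
have [dm dn] := (bd m, bd n).
rewrite -ler_sqr ?nnegrE ?rnorm_ge0 ?(ltW d0)// rnormDsqr rnormN.
rewrite Bm Bn innerNr innerZr innerZl oe ltn_eqF// !mulr0 oppr0 mulr0 addr0.
rewrite !rnormZ !rnorm_real !(rnorm_orthonormal _ oe) !mulr1.
have : d ^+ 2 <= `|b m| ^+ 2 by rewrite ler_sqr ?nnegrE ?(ltW d0).
by move=> /le_trans; apply; rewrite lerDl sqr_ge0.
Qed.

End CompactSymmetric.

(** * Diagonal operators and singular values *)

(** Totality is stated as triviality of the orthocomplement, the form in which the eigenvectors
    arrive; approximation by partial sums is recovered in [basis_expansion]. *)
Definition hilbert_basis (R : realType) (H : hilbertType R) (e : nat -> H) : Prop :=
  orthonormal e /\ forall x, (forall n, inner x (e n) = 0) -> x = 0.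

Section RieszFischer.
Context {R : realType} {H : hilbertType R} (e : nat -> H).
Hypothesis oe : orthonormal e.
Variables (c : nat -> R[i]) (M : R).
Hypothesis cM : forall N, \sum_(n < N) rnorm (c n) ^+ 2 <= M.

Let s N : H := \sum_(n < N) c n *: e n.
Let A N : R := \sum_(n < N) rnorm (c n) ^+ 2.

Let inner_s N m : inner (s N) (e m) = if (m < N)%N then c m else 0.
Proof.
rewrite /s inner_suml; case: ifPn => [mN|].
  rewrite (bigD1 (Ordinal mN))//= innerZl oe eqxx mulr1 big1 ?addr0// => i im.
  by rewrite innerZl oe (_ : (_ == _) = false) ?mulr0//; exact: negbTE.
rewrite -leqNgt => Nm; rewrite big1// => i _.
by rewrite innerZl oe ltn_eqF ?mulr0// (leq_trans (ltn_ord i)).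
Qed.

Let rnorm_s N k : rnorm (s (N + k) - s N) ^+ 2 = A (N + k) - A N.
Proof.
elim: k => [|k ih]; first by rewrite addn0 !subrr rnorm0 expr0n.
rewrite addnS /s /A !big_ord_recr/= -/(s (N + k)) -/(s N) -/(A (N + k)) -/(A N).
rewrite addrAC rnormDsqr ih innerZr innerBl !inner_s ltnn.
rewrite (ltnNge _ N) leq_addr/= subrr !mulr0 addr0 rnormZ.
by rewrite (rnorm_orthonormal _ oe) mulr1 addrAC.
Qed.

(** The squared distance of two partial sums is a difference of values of [A], and beyond a suitable
    [N] these are within [(d / 2)^2] of their supremum. *)
Let s_cauchy (d : R) : 0 < d -> exists N, forall m n, (N <= m)%N -> (N <= n)%N ->
  rnorm (s m - s n) < d.
Proof.
move=> d0; have d20 : 0 < d / 2 by rewrite divr_gt0.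
have supA : has_sup (range A).
  by split; [exists (A 0%N), 0%N|exists M => _ [N _ <-]; exact: cM].
have [_ [N _ <-] AN] := sup_adherent (exprn_gt0 2 d20) supA.
have h n : (N <= n)%N -> rnorm (s n - s N) < d / 2.
  move=> Nn; rewrite -ltr_sqr ?nnegrE ?rnorm_ge0 ?(ltW d20)//.
  rewrite -(subnKC Nn) rnorm_s subnKC//.
  have : A n <= sup (range A) by apply: ub_le_sup; [case: supA|exists n].
  by lra.
exists N => m n Nm Nn.
have -> : s m - s n = (s m - s N) - (s n - s N) by rewrite opprB addrA subrK.
by rewrite (le_lt_trans (rnormB _ _))// (splitr d) ltrD ?h.
Qed.

Lemma riesz_fischer : exists y, [/\ forall n, inner y (e n) = c n,
  rnorm y ^+ 2 <= M &
  forall d : R, 0 < d -> exists N, rnorm (\sum_(n < N) c n *: e n - y) < d].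
Proof.
have [y yP] := rcauchy_cvg s_cauchy; exists y; split.
- move=> n; apply/eqP; rewrite -subr_eq0; apply/eqP.
  apply: (@rnorm_small0 _ _ _ 1) => d d0; have [N NP] := yP d d0.
  have := NP (maxn N n.+1) (leq_maxl _ _); set K := maxn _ _ => hK.
  have <- : inner (s K) (e n) = c n by rewrite inner_s /K leq_maxr.
  rewrite -innerBl (le_trans (cauchy_schwarz _ _))// (rnorm_orthonormal _ oe).
  by rewrite mulr1 mul1r rdistC ltW.
- have M0 : 0 <= M by have := cM 0; rewrite big_ord0.
  rewrite -(sqr_sqrtr M0) ler_sqr ?nnegrE ?rnorm_ge0 ?sqrtr_ge0//.
  apply/ler_addgt0Pr => d d0; have [N /(_ N (leqnn N)) NP] := yP d d0.
  rewrite -[y](subrK (s N)) addrC (le_trans (rnormD _ _))// lerD//.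
    rewrite -ler_sqr ?nnegrE ?rnorm_ge0 ?sqrtr_ge0// sqr_sqrtr//.
    have := rnorm_s 0 N; rewrite add0n /s /A !big_ord0 !subr0 => ->.
    exact: cM.
  by rewrite rdistC ltW.
- by move=> d /yP[N /(_ N (leqnn N))]; exists N.
Qed.

End RieszFischer.

Section HilbertBasis.
Context {R : realType} {H : hilbertType R} (e : nat -> H).
Hypothesis be : hilbert_basis e.
Let oe := be.1.
Implicit Types (x y z : H) (T S : H -> H).

Lemma basis_inj x y : (forall n, inner x (e n) = inner y (e n)) -> x = y.
Proof.
move=> xy; apply/eqP; rewrite -subr_eq0; apply/eqP; apply: be.2 => n.
by rewrite innerBl xy subrr.
Qed.

Lemma basis_bessel x N : \sum_(n < N) rnorm (inner x (e n)) ^+ 2 <= rnorm x ^+ 2.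
Proof.
have oN : orthonormal (fun i : 'I_N => e i) by move=> i j; rewrite oe.
exact: bessel oN x.
Qed.

(** The Riesz-Fischer sum of the coefficients of [x] has the same coefficients as [x], hence is
    [x]. *)
Lemma basis_expansion x (d : R) : 0 < d ->
  exists N, rnorm (\sum_(n < N) inner x (e n) *: e n - x) < d.
Proof.
move=> d0.
have [y [yx _ yP]] :=
  riesz_fischer oe (c := fun n => inner x (e n)) (basis_bessel x).
by rewrite (basis_inj yx) in yP; exact: yP.
Qed.

(** The density argument, done once on functionals: identities between bounded operators are deduced
    by applying it to a difference of inner products. *)
Lemma functional_ext (phi : H -> R[i]) (C : R) :
  (forall k x y, phi (k *: x + y) = k * phi x + phi y) ->
  (forall x, rnorm (phi x) <= C * rnorm x) -> (forall n, phi (e n) = 0) ->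
  forall x, phi x = 0.
Proof.
move=> lphi bphi phie x.
apply: (@rnorm_small0 _ _ _ `|C|) => d d0; have [N NP] := basis_expansion x d0.
have phi0 : phi 0 = 0.
  by apply: rnorm_le0; rewrite (le_trans (bphi 0))// rnorm0 mulr0.
have phis (c : nat -> R[i]) n : phi (\sum_(i < n) c i *: e i) = 0.
  elim: n => [|n ih]; first by rewrite big_ord0.
  by rewrite big_ord_recr/= addrC lphi ih phie mulr0 addr0.
set s := \sum_(n < N) _ in NP.
have -> : phi x = phi (x - s).
  rewrite [x - s]addrC -scaleN1r lphi (_ : phi s = 0) ?mulr0 ?add0r//.
  exact: (phis (fun n => inner x (e n))).
rewrite (le_trans (bphi _))// (le_trans (_ : _ <= `|C| * rnorm (x - s)))//.
  by rewrite ler_wpM2r ?rnorm_ge0// ler_norm.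
by rewrite ler_wpM2l// rdistC ltW.
Qed.

Lemma bounded_ext S T : bounded_op S -> bounded_op T ->
  (forall n, S (e n) = T (e n)) -> S = T.
Proof.
move=> /bounded_opP[lS [c [c0 Sc]]] /bounded_opP[lT [d [d0 Td]]] ST.
apply/funext => x; apply: basis_inj => m; apply/eqP; rewrite -subr_eq0.
rewrite -innerBl; apply/eqP.
apply: (@functional_ext (fun x => inner (S x - T x) (e m)) (c + d)) => [k u v|u|n].
- by rewrite lS lT opprD addrACA -scalerBr inner_linearl.
- rewrite (le_trans (cauchy_schwarz _ _))// (rnorm_orthonormal _ oe) mulr1.
  by rewrite (le_trans (rnormB _ _))// mulrDl lerD.
- by rewrite ST subrr inner0l.
Qed.

(** The coefficients [p n <x, e n>] are square summable, so Riesz-Fischer gives a value at each [x];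
    linearity follows because coefficients determine a vector. *)
Lemma diagonal_exists (p : nat -> R) (C : R) : (forall n, `|p n| <= C) ->
  exists2 T, bounded_op T & forall n, T (e n) = (p n)%:C *: e n.
Proof.
move=> pC; have C0 : 0 <= C := le_trans (normr_ge0 _) (pC 0%N).
pose Q x y := (forall n, inner y (e n) = (p n)%:C * inner x (e n)) /\
  rnorm y <= C * rnorm x.
have [T TP] : {T : H -> H & forall x, Q x (T x)}.
  apply: (@choice _ _ Q) => x.
  have bd N : \sum_(n < N) rnorm ((p n)%:C * inner x (e n)) ^+ 2 <=
      C ^+ 2 * rnorm x ^+ 2.
    rewrite (@le_trans _ _ (C ^+ 2 * \sum_(n < N) rnorm (inner x (e n)) ^+ 2))//.
      rewrite mulr_sumr ler_sum// => i _; rewrite rnormM rnorm_real exprMn.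
      by rewrite ler_wpM2r ?sqr_ge0// ler_sqr ?nnegrE.
    by rewrite ler_wpM2l ?sqr_ge0// basis_bessel.
  have [y [yx yn _]] :=
    riesz_fischer oe (c := fun n => (p n)%:C * inner x (e n)) bd.
  exists y; split=> //.
  by rewrite -ler_sqr ?nnegrE ?mulr_ge0 ?rnorm_ge0// exprMn.
exists T.
  apply/bounded_opP; split; last by exists C; split=> // x; case: (TP x).
  move=> k x y; apply: basis_inj => n.
  have [tx _] := TP x; have [ty _] := TP y; have [txy _] := TP (k *: x + y).
  by rewrite txy !inner_linearl tx ty; ring.
move=> n; apply: basis_inj => m; have [tn _] := TP (e n).
by rewrite tn innerZl oe; case: eqVneq => [->//|]; rewrite !mulr0.
Qed.

Section Diagonal.
Variables (T : H -> H) (p : nat -> R).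
Hypothesis bT : bounded_op T.
Hypothesis Te : forall n, T (e n) = (p n)%:C *: e n.

Lemma diagonal_coef x n : inner (T x) (e n) = (p n)%:C * inner x (e n).
Proof.
have [lT [c [c0 Tc]]] := iffLR (bounded_opP T) bT.
apply/eqP; rewrite -subr_eq0; apply/eqP.
apply: (@functional_ext (fun x => inner (T x) (e n) - (p n)%:C * inner x (e n))
    (c + `|p n|)) => [k u v|u|m].
- by rewrite /= lT !inner_linearl; ring.
- rewrite (le_trans (rnormB _ _))// mulrDl lerD//.
    rewrite (le_trans (cauchy_schwarz _ _))// (rnorm_orthonormal _ oe) mulr1//.
  rewrite rnormM rnorm_real ler_wpM2l//.
  by rewrite (le_trans (cauchy_schwarz _ _))// (rnorm_orthonormal _ oe) mulr1.
- rewrite Te innerZl oe; case: eqVneq => [->|]; first by rewrite subrr.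
  by rewrite !mulr0 subrr.
Qed.

Lemma diagonal_sym x y : inner (T x) y = inner x (T y).
Proof.
have [lT [c [c0 Tc]]] := iffLR (bounded_opP T) bT.
apply/eqP; rewrite -subr_eq0; apply/eqP.
apply: (@functional_ext (fun x => inner (T x) y - inner x (T y))
    (c * rnorm y + rnorm (T y))) => [k u v|u|m].
- by rewrite /= lT !inner_linearl; ring.
- rewrite (le_trans (rnormB _ _))// mulrDl lerD// (le_trans (cauchy_schwarz _ _))//.
    by rewrite mulrAC ler_wpM2r ?rnorm_ge0.
  by rewrite mulrC.
- rewrite Te innerZl [inner _ (T y)]innerC diagonal_coef rmorphM/= conj_real.
  by rewrite -innerC subrr.
Qed.

Lemma diagonal_bounded : exists C : R, forall n, `|p n| <= C.
Proof.
have [lT [c [c0 Tc]]] := iffLR (bounded_opP T) bT.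
exists c => n; have := Tc (e n).
by rewrite Te rnormZ (rnorm_orthonormal _ oe) !mulr1 rnorm_real.
Qed.

End Diagonal.

(** With [Q] diagonal of entries [sqrt (p n)], [T = Q^2] and [<T x, x> = |Q x|^2]. *)
Lemma diagonal_positive T (p : nat -> R) : bounded_op T ->
  (forall n, T (e n) = (p n)%:C *: e n) -> (forall n, 0 <= p n) -> positive_op T.
Proof.
move=> bT Te p0; split=> // x; have [C pC] := diagonal_bounded bT Te.
have [|Q bQ Qe] := @diagonal_exists (fun n => Num.sqrt (p n)) (Num.sqrt C).
  move=> n; rewrite ger0_norm ?sqrtr_ge0// ler_sqrt//.
    by rewrite (le_trans _ (pC n))// ler_norm.
  by rewrite (le_trans _ (pC n)).
have [lQ [c [c0 Qc]]] := iffLR (bounded_opP Q) bQ.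
have -> : T = Q \o Q.
  apply: bounded_ext => // [|n /=]; last first.
    by rewrite Qe (linearZE lQ) Qe scalerA -rmorphM/= -expr2 sqr_sqrtr.
  apply/bounded_opP; split; first by move=> k u v /=; rewrite !lQ.
  exists (c * c); split=> [|u /=]; first exact: mulr_ge0.
  by rewrite (le_trans (Qc _))// -mulrA ler_wpM2l.
by rewrite /= (diagonal_sym bQ Qe) inner_rnorm lecR sqr_ge0.
Qed.

(** Uniqueness of the positive root: if [b^2 = T^2], then [y = b (e n) - p n e n] satisfies
    [b y = - p n y], and positivity of [b] with [p n > 0] leaves only [y = 0]. *)
Lemma abs_op_diagonal T (p : nat -> R) : bounded_op T ->
  (forall n, T (e n) = (p n)%:C *: e n) -> (forall n, 0 < p n) -> abs_op T = T.
Proof.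
move=> bT Te p0; have sT := diagonal_sym bT Te.
have [lT _] := iffLR (bounded_opP T) bT.
apply: xget_unique.
  split; first by apply: (diagonal_positive bT Te) => n; exact: ltW.
  by exists T => // x y; rewrite sT.
move=> b [[bb b0] [a' ad bba]]; have [lb _] := iffLR (bounded_opP b) bb.
have a'T y : a' y = T y.
  by apply: inner_inj => x; rewrite (innerC (a' y)) (innerC (T y)) -ad sT.
apply: bounded_ext => // n; apply/eqP; rewrite -subr_eq0; apply/eqP.
set y := b (e n) - _.
have by_ : b y = - (p n)%:C *: y.
  rewrite /y (linearBE lb) bba a'T Te (linearZE lT) (linearZE lb) Te.
  by rewrite scalerBr scaleNr scaleNr opprK addrC.
have := b0 y; rewrite by_ innerZl inner_rnorm -rmorphN -rmorphM/= lecR.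
rewrite mulNr oppr_ge0.
rewrite pmulr_rle0// => h; apply: rnorm0_eq0; apply/eqP.
by rewrite -sqrf_eq0 eq_le h sqr_ge0.
Qed.

End HilbertBasis.

(** * Uniqueness of the eigenvalue sequence *)

Section SingularValues.
Context {R : realType} {H : hilbertType R} (T : H -> H).
Hypothesis lT : linear T.
Hypothesis symT : forall x y, inner (T x) y = inner x (T y).
Hypothesis posT : forall x, 0 <= inner (T x) x.

Lemma eigenvectors_orthogonal (a b : R) u v :
  T u = a%:C *: u -> T v = b%:C *: v -> a != b -> inner u v = 0.
Proof.
move=> Tu Tv ab; have := symT u v; rewrite Tu Tv innerZl innerZr conj_real.
move=> /eqP; rewrite -subr_eq0 -mulrBl mulf_eq0 -rmorphB/= => /orP[|/eqP//].
by rewrite eq_complex/= eqxx andbT subr_eq0 (negbTE ab).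
Qed.

(** If [nu n < mu n], projecting [e k], [k <= n], off [f 0], ..., [f (n - 1)] leaves an eigenvector
    for [mu k > 0] orthogonal to all of [f], hence [0]. So [n + 1] orthonormal vectors would lie in
    a span of [n]. *)
Lemma eigenvalue_sequence_le (mu nu : nat -> R) n :
  eigenvalue_sequence T mu -> eigenvalue_sequence T nu -> mu n <= nu n.
Proof.
move=> [mono_mu [e [oe Te _]]] [mono_nu [f [of_ Tf fmax]]].
rewrite leNgt; apply/negP => nmu.
have nu0 : 0 <= nu n.
  have := posT (f n); rewrite Tf innerZl of_ eqxx mulr1.
  by rewrite lecR.
have oe' : orthonormal (fun k : 'I_n.+1 => e k) by move=> i j; rewrite oe.
have of' : orthonormal (fun k : 'I_n => f k) by move=> i j; rewrite of_.
suff : (#|'I_n.+1| <= #|'I_n|)%N by rewrite !card_ord ltnn.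
apply: (card_orthonormal_le oe' of') => k.
have muk : mu n <= mu k by rewrite mono_mu// -ltnS.
set P := proj _ _; apply/eqP; rewrite -subr_eq0; apply/eqP.
have Pf j : (n <= j)%N -> inner P (f j) = 0.
  move=> nj; rewrite inner_suml big1// => i _.
  by rewrite innerZl of_ ltn_eqF ?mulr0// (leq_trans (ltn_ord i)).
apply: (fmax (mu k)).
- by rewrite gt_eqF// (lt_le_trans _ muk)// (le_lt_trans nu0).
- rewrite (linearBE lT) Te scalerBr; congr (_ - _).
  rewrite /P /proj (linear_sumE _ _ _ lT) scaler_sumr; apply: eq_bigr => i _.
  rewrite (linearZE lT) Tf !scalerA.
  have [->|ik] := eqVneq (mu k) (nu i); first by rewrite mulrC.
  by rewrite (eigenvectors_orthogonal (Te k) (Tf i) ik) mulr0 mul0r !scale0r.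
- move=> j; have [jn|nj] := ltnP j n.
    exact: (inner_subproj of' (e k) (Ordinal jn)).
  rewrite innerBl Pf// subr0; apply: (eigenvectors_orthogonal (Te k) (Tf j)).
  by rewrite gt_eqF// (le_lt_trans (mono_nu _ _ nj))// (lt_le_trans nmu).
Qed.

End SingularValues.

Lemma singular_value_diagonal (R : realType) (H : hilbertType R) (e : nat -> H)
    (T : H -> H) (p : nat -> R) :
  hilbert_basis e -> bounded_op T -> (forall n, T (e n) = (p n)%:C *: e n) ->
  (forall n, 0 < p n) -> {homo p : m n / (m <= n)%N >-> n <= m} ->
  singular_value T = p.
Proof.
move=> be bT Te p0 pmono; have sT := diagonal_sym be bT Te.
have [lT _] := iffLR (bounded_opP T) bT.
have [_ posT] := diagonal_positive be bT Te (fun n => ltW (p0 n)).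
rewrite /singular_value (abs_op_diagonal be bT Te p0).
have Tp : eigenvalue_sequence T p.
  split=> //; exists e; split=> [m n|//|l x _ _ xe]; first exact: be.1.
  exact: be.2.
apply: xget_unique => // q Tq; apply/funext => n.
by apply/eqP; rewrite eq_le; apply/andP; split;
  exact: (eigenvalue_sequence_le lT sT posT).
Qed.

(** * Spectra of spectral triples *)

Definition eigenbasis (R : realType) (H : hilbertType R) (D : unbounded_op H)
    (e : nat -> H) (l : nat -> R) : Prop :=
  [/\ hilbert_basis e, forall n, opdom D (e n),
      forall n, D (e n) = (l n)%:C *: e n, forall n, 0 < `|l n| &
      {homo l : m n / (m <= n)%N >-> `|m| <= `|n|}].

Section TripleSpectrum.
Context {R : realType} {H : hilbertType R}.
Variables (A : set (H -> H)) (D : unbounded_op H).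
Hypothesis tD : spectral_triple A D.
Let saD := triple_self_adjoint tD.
Implicit Types (x y z u v : H) (e : nat -> H).

Lemma triple_eigenbasis : exists e l, eigenbasis D e l.
Proof.
have [B [cB BP]] := compact_inverse saD (triple_resolvent tD)
  (@triple_injective _ _ _ _ tD).
have symB x y : inner (B x) y = inner x (B y).
  have [dx Dx] := BP x; have [dy Dy] := BP y.
  by rewrite -{2}Dx self_adjoint_sym// Dy.
have injB x : B x = 0 -> x = 0.
  by have [_ Dx] := BP x => Bx; rewrite -Dx Bx opfun0.
have [e [b [oe Be b0 bmono emax]]] :=
  compact_symmetric_eigenbasis (triple_infinite tD) cB symB injB.
have eE n : e n = ((b n)^-1)%:C *: B (e n).
  by rewrite Be scalerA -rmorphM/= mulVf ?scale1r.
have de n : opdom D (e n) by rewrite eE; apply: opdomZ; case: (BP (e n)).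
exists e, (fun n => (b n)^-1); split=> // n.
- have [dB DB] := BP (e n); rewrite {1}eE opfunZ// DB//.
- by rewrite normr_gt0 invr_eq0.
- move=> m nm; rewrite !normfV lef_pV2 ?posrE ?normr_gt0//; exact: bmono.
Qed.

Lemma op_eigenvectors_orthogonal (a b : R) u v : opdom D u -> opdom D v ->
  D u = a%:C *: u -> D v = b%:C *: v -> a != b -> inner u v = 0.
Proof.
move=> du dv Du Dv ab; have := self_adjoint_sym saD du dv.
rewrite Du Dv innerZl innerZr conj_real.
move=> /eqP; rewrite -subr_eq0 -mulrBl mulf_eq0 -rmorphB/= => /orP[|/eqP//].
by rewrite eq_complex/= eqxx andbT subr_eq0 (negbTE ab).
Qed.

(** The diagonal operator with entries [phi (l n)] is a witness: an eigenvector for [a] has no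
    component along [e n] unless [l n = a]. *)
Lemma functional_calculusP (phi : R -> R) (C : R) e l : eigenbasis D e l ->
  (forall n, `|phi (l n)| <= C) ->
  bounded_op (functional_calculus D phi) /\
  forall (a : R) x, opdom D x -> D x = a%:C *: x ->
    functional_calculus D phi x = (phi a)%:C *: x.
Proof.
move=> [be de De _ _] phiC.
have [T bT Te] := diagonal_exists be phiC.
apply: (@xgetPex _ (fun=> 0) [set T : H -> H | bounded_op T /\
  forall (a : R) x, opdom D x -> D x = a%:C *: x -> T x = (phi a)%:C *: x]).
exists T; split=> // a x dx Dx; apply: (basis_inj be) => n.
rewrite (diagonal_coef be bT Te) innerZl.
have [->//|aln] := eqVneq a (l n).
by rewrite (op_eigenvectors_orthogonal dx (de n) Dx (De n) aln) !mulr0.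
Qed.

Section Basis.
Variables (e : nat -> H) (l : nat -> R).
Hypothesis eD : eigenbasis D e l.

Lemma eigenvalue_powRN_le (d : R) m n : 0 <= d -> (m <= n)%N ->
  `|l n| `^ (- d) <= `|l m| `^ (- d).
Proof.
move=> d0 mn; have [_ _ _ l0 lmono] := eD.
rewrite !powRN lef_pV2 ?posrE ?powR_gt0//.
by rewrite ge0_ler_powR ?nnegrE// lmono.
Qed.

Lemma abs_inv_powP (d : R) : 0 <= d -> bounded_op (abs_inv_pow D d) /\
  forall (a : R) x, opdom D x -> D x = a%:C *: x ->
    abs_inv_pow D d x = (`|a| `^ (- d))%:C *: x.
Proof.
move=> d0; apply: (functional_calculusP (C := `|l 0%N| `^ (- d)) eD) => n.
by rewrite ger0_norm ?powR_ge0// eigenvalue_powRN_le.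
Qed.

Lemma abs_inv_pow_basis (d : R) n : 0 <= d ->
  abs_inv_pow D d (e n) = (`|l n| `^ (- d))%:C *: e n.
Proof. by case: eD => _ de De _ _ /abs_inv_powP[_]; exact. Qed.

Lemma singular_value_abs_inv_pow (d : R) : 0 <= d ->
  singular_value (abs_inv_pow D d) = fun n => `|l n| `^ (- d).
Proof.
move=> d0; have [be _ _ l0 _] := eD; have [bT _] := abs_inv_powP d0.
apply: (singular_value_diagonal be bT) => [n|n|m n mn].
- exact: abs_inv_pow_basis.
- exact: powR_gt0.
- exact: eigenvalue_powRN_le.
Qed.

(** Such eigenvectors are orthogonal to every [e j] with [j >= n], so they lie in the span of the
    first [n] basis vectors. *)
Lemma card_small_eigenvectors n (I : finType) (f : I -> H) (a : I -> R) :
  orthonormal f -> (forall i, opdom D (f i)) ->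
  (forall i, D (f i) = (a i)%:C *: f i) -> (forall i, `|a i| < `|l n|) ->
  (#|I| <= n)%N.
Proof.
have [be de De _ lmono] := eD.
move=> of_ df Df an; rewrite -[leqRHS]card_ord.
have oe' : orthonormal (fun k : 'I_n => e k) by move=> i j; rewrite be.1.
apply: (card_orthonormal_le of_ oe') => i; apply/eqP; rewrite -subr_eq0; apply/eqP.
apply: be.2 => j; have [jn|nj] := ltnP j n.
  exact: (inner_subproj oe' (f i) (Ordinal jn)).
rewrite innerBl (op_eigenvectors_orthogonal (df i) (de j) (Df i) (De j)).
  rewrite inner_suml big1 ?subrr// => k _.
  by rewrite innerZl be.1 ltn_eqF ?mulr0// (leq_trans (ltn_ord k)).
by apply: contraTneq (an i) => ->; rewrite -leNgt lmono.
Qed.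

End Basis.

End TripleSpectrum.

(** * Spectrum of the direct sum *)

Section SumSpectrum.
Context {R : realType} {H1 H2 : hilbertType R}.
Variables (A1 : set (H1 -> H1)) (D1 : unbounded_op H1).
Variables (A2 : set (H2 -> H2)) (D2 : unbounded_op H2).
Variables (A : set (hsum H1 H2 -> hsum H1 H2)).
Local Notation H := (hsum H1 H2).
Local Notation D := (opsum D1 D2).
Hypothesis t1 : spectral_triple A1 D1.
Hypothesis t2 : spectral_triple A2 D2.
Hypothesis tD : spectral_triple A D.
Variables (e1 : nat -> H1) (l1 : nat -> R) (e2 : nat -> H2) (l2 : nat -> R).
Variables (e : nat -> H) (l : nat -> R).
Hypothesis eD1 : eigenbasis D1 e1 l1.
Hypothesis eD2 : eigenbasis D2 e2 l2.
Hypothesis eD : eigenbasis D e l.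

Lemma inner_hsumE (x y : H) : inner x y = inner x.1 y.1 + inner x.2 y.2.
Proof. by []. Qed.

Lemma opsum_inl (x : H1) (a : R) : opdom D1 x -> D1 x = a%:C *: x ->
  opdom D ((x, 0) : H) /\ D ((x, 0) : H) = a%:C *: ((x, 0) : H).
Proof.
move=> dx Dx; split; first by split=> //; exact: opdom0.
by rewrite /= Dx opfun0; congr pair; rewrite scaler0.
Qed.

Lemma opsum_inr (x : H2) (a : R) : opdom D2 x -> D2 x = a%:C *: x ->
  opdom D ((0, x) : H) /\ D ((0, x) : H) = a%:C *: ((0, x) : H).
Proof.
move=> dx Dx; split; first by split=> //; exact: opdom0.
by rewrite /= Dx opfun0; congr pair; rewrite scaler0.
Qed.

(** Were it false, the [n + 1] eigenvectors [(e1 k, 0)], [k <= n], would all have eigenvalues below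
    [|l n|] in modulus. *)
Lemma opsum_eigenvalue_le1 n : `|l n| <= `|l1 n|.
Proof.
have [be1 de1 De1 _ lmono1] := eD1; rewrite leNgt; apply/negP => ln.
suff : (#|'I_n.+1| <= n)%N by rewrite card_ord ltnn.
apply: (card_small_eigenvectors tD eD (f := fun k : 'I_n.+1 => (e1 k, 0))
  (a := fun k => l1 k)).
- by move=> i j; rewrite inner_hsumE/= inner0l addr0 be1.1.
- by move=> i; case: (opsum_inl (de1 i) (De1 i)).
- by move=> i; case: (opsum_inl (de1 i) (De1 i)).
- by move=> i; rewrite (le_lt_trans _ ln)// lmono1// -ltnS.
Qed.

Lemma opsum_eigenvalue_le2 n : `|l n| <= `|l2 n|.
Proof.
have [be2 de2 De2 _ lmono2] := eD2; rewrite leNgt; apply/negP => ln.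
suff : (#|'I_n.+1| <= n)%N by rewrite card_ord ltnn.
apply: (card_small_eigenvectors tD eD (f := fun k : 'I_n.+1 => (0, e2 k))
  (a := fun k => l2 k)).
- by move=> i j; rewrite inner_hsumE/= inner0l add0r be2.1.
- by move=> i; case: (opsum_inr (de2 i) (De2 i)).
- by move=> i; case: (opsum_inr (de2 i) (De2 i)).
- by move=> i; rewrite (le_lt_trans _ ln)// lmono2// -ltnS.
Qed.

(** Put [m = n./2]. If [|l n|] were below both [|l1 m|] and [|l2 m|], the [n + 1] vectors [e k],
    [k <= n], would lie in the span of the [2 m <= n] vectors [(e1 j, 0)] and [(0, e2 j)] with
    [j < m]. *)
Lemma opsum_eigenvalue_ge n : Num.min `|l1 n./2| `|l2 n./2| <= `|l n|.
Proof.
have [be1 de1 De1 _ lmono1] := eD1; have [be2 de2 De2 _ lmono2] := eD2.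
have [be de De _ lmono] := eD.
rewrite leNgt lt_min; apply/negP => /andP[ln1 ln2]; set m := n./2 in ln1 ln2.
pose g (i : 'I_m + 'I_m) : H :=
  match i with inl j => (e1 j, 0) | inr j => (0, e2 j) end.
have oe : orthonormal (fun k : 'I_n.+1 => e k) by move=> i j; rewrite be.1.
have og : orthonormal g.
  move=> [i|i] [j|j]; rewrite inner_hsumE/= ?inner0l ?inner0r ?addr0 ?add0r//.
    exact: be1.1.
  exact: be2.1.
suff : (#|'I_n.+1| <= #|{: 'I_m + 'I_m}|)%N.
  rewrite card_sum !card_ord addnn leqNgt ltnS => /negP; apply.
  by rewrite /m -[leqRHS]odd_double_half leq_addl.
apply: (card_orthonormal_le oe og) => k; apply/eqP; rewrite -subr_eq0; apply/eqP.
have [du dv] := de k.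
have Du : D1 (e k).1 = (l k)%:C *: (e k).1 by have := congr1 fst (De k).
have Dv : D2 (e k).2 = (l k)%:C *: (e k).2 by have := congr1 snd (De k).
have lkn : `|l k| <= `|l n| by rewrite lmono// -ltnS.
set r := e k - proj g (e k).
have rg i : inner r (g i) = 0 := inner_subproj og (e k) i.
(* The first component of [e k] solves the eigenvalue equation of [D1] for [l k], so it is
   orthogonal to [e1 j] for [j >= m], where [|l1 j| > |l k|]. *)
have r1 : r.1 = 0.
  apply: be1.2 => j; have -> : inner r.1 (e1 j) = inner r ((e1 j, 0) : H).
    by rewrite inner_hsumE/= inner0r addr0.
  have [jm|mj] := ltnP j m; first exact: (rg (inl (Ordinal jm))).
  rewrite /r innerBl inner_hsumE/= inner0r addr0.
  rewrite (op_eigenvectors_orthogonal t1 du (de1 j) Du (De1 j)).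
    rewrite sub0r inner_suml big1 ?oppr0// => -[i|i] _;
        rewrite innerZl [X in _ * X]inner_hsumE/=.
      by rewrite inner0r addr0 be1.1 ltn_eqF ?mulr0// (leq_trans (ltn_ord i)).
    by rewrite inner0l inner0r addr0 mulr0.
  apply: contraTneq ln1 => lk; rewrite -leNgt (le_trans _ lkn)// lk.
  exact: lmono1.
have r2 : r.2 = 0.
  apply: be2.2 => j; have -> : inner r.2 (e2 j) = inner r ((0, e2 j) : H).
    by rewrite inner_hsumE/= inner0r add0r.
  have [jm|mj] := ltnP j m; first exact: (rg (inr (Ordinal jm))).
  rewrite /r innerBl inner_hsumE/= inner0r add0r.
  rewrite (op_eigenvectors_orthogonal t2 dv (de2 j) Dv (De2 j)).
    rewrite sub0r inner_suml big1 ?oppr0// => -[i|i] _;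
        rewrite innerZl [X in _ * X]inner_hsumE/=.
      by rewrite inner0l inner0r addr0 mulr0.
    by rewrite inner0r add0r be2.1 ltn_eqF ?mulr0// (leq_trans (ltn_ord i)).
  apply: contraTneq ln2 => lk; rewrite -leNgt (le_trans _ lkn)// lk.
  exact: lmono2.
by case: r r1 r2 {rg} => /= a b -> ->.
Qed.

Lemma rnorm_hsum (u : H) : rnorm u ^+ 2 = rnorm u.1 ^+ 2 + rnorm u.2 ^+ 2.
Proof.
by apply: complexI; rewrite -inner_rnorm inner_hsumE !inner_rnorm rmorphD.
Qed.

Lemma rnorm_hsum_ge1 (u : H) : rnorm u.1 <= rnorm u.
Proof. by rewrite -ler_sqr ?nnegrE ?rnorm_ge0// rnorm_hsum lerDl sqr_ge0. Qed.

Lemma rnorm_hsum_ge2 (u : H) : rnorm u.2 <= rnorm u.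
Proof. by rewrite -ler_sqr ?nnegrE ?rnorm_ge0// rnorm_hsum lerDr sqr_ge0. Qed.

Lemma rnorm_hsum_le (u : H) : rnorm u <= rnorm u.1 + rnorm u.2.
Proof.
rewrite -ler_sqr ?nnegrE ?addr_ge0 ?rnorm_ge0// rnorm_hsum sqrrD.
by rewrite addrAC lerDl mulrn_wge0// mulr_ge0 ?rnorm_ge0.
Qed.

(** Both sides are bounded and agree on the basis [e], since the components of [e n] satisfy the
    eigenvalue equations of [D1] and [D2] for the same [l n]. *)
Lemma abs_inv_pow_opsum (d : R) : 0 <= d -> abs_inv_pow D d =
  (fun x : H => (abs_inv_pow D1 d x.1, abs_inv_pow D2 d x.2) : H).
Proof.
move=> d0.
have [b1 T1] := abs_inv_powP t1 eD1 d0; have [b2 T2] := abs_inv_powP t2 eD2 d0.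
have [bT Te] := abs_inv_powP tD eD d0; have [be de De _ lmono] := eD.
have [lin1 [c1 [c10 n1]]] := iffLR (bounded_opP _) b1.
have [lin2 [c2 [c20 n2]]] := iffLR (bounded_opP _) b2.
have [lin _] := iffLR (bounded_opP _) bT.
apply: (bounded_ext be bT) => [|n].
  apply/bounded_opP; split.
    by move=> k u v; rewrite /= lin1 lin2.
  exists (c1 + c2); split=> [|u]; first exact: addr_ge0.
  rewrite (le_trans (rnorm_hsum_le _))// mulrDl lerD//=.
    by rewrite (le_trans (n1 _))// ler_wpM2l// rnorm_hsum_ge1.
  by rewrite (le_trans (n2 _))// ler_wpM2l// rnorm_hsum_ge2.
have [du dv] := de n.
rewrite (Te _ _ (de n) (De n)) (T1 (l n))//; last by have := congr1 fst (De n).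
by rewrite (T2 (l n))//; have := congr1 snd (De n).
Qed.

Lemma compact_abs_inv_pow_opsum (d : R) : 0 <= d ->
  compact_op (abs_inv_pow D d) <->
  compact_op (abs_inv_pow D1 d) /\ compact_op (abs_inv_pow D2 d).
Proof.
move=> d0.
have [b1 _] := abs_inv_powP t1 eD1 d0; have [b2 _] := abs_inv_powP t2 eD2 d0.
have [bT _] := abs_inv_powP tD eD d0; have TE := abs_inv_pow_opsum d0.
pose inl (x : H1) : H := (x, 0); pose inr (x : H2) : H := (0, x).
have ninl x : rnorm (inl x) = rnorm x.
  apply/eqP; rewrite -(@eqrXn2 _ 2) ?rnorm_ge0// rnorm_hsum/= rnorm0.
  by rewrite expr0n/= addr0.
have ninr x : rnorm (inr x) = rnorm x.
  apply/eqP; rewrite -(@eqrXn2 _ 2) ?rnorm_ge0// rnorm_hsum/= rnorm0.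
  by rewrite expr0n/= add0r.
split=> [/compact_op_unit[cK TK]|
  [/compact_op_unit[cK1 TK1] /compact_op_unit[cK2 TK2]]].
  split.
    apply: (@compact_op_sub _ _ _ ((fst : H -> H1) @`
        closure (abs_inv_pow D d @` [set x | `|x| <= 1]))); first by case: b1.
      apply: continuous_compact cK; apply: continuous_subspaceT.
      apply: (@rlip_map_continuous _ _ _ _ 1) => x y; rewrite mul1r.
      exact: (rnorm_hsum_ge1 (x - y)).
    move=> x x1; exists (abs_inv_pow D d (inl x)); last by rewrite TE.
    by apply: TK; rewrite ninl.
  apply: (@compact_op_sub _ _ _ ((snd : H -> H2) @`
      closure (abs_inv_pow D d @` [set x | `|x| <= 1]))); first by case: b2.
    apply: continuous_compact cK; apply: continuous_subspaceT.
    apply: (@rlip_map_continuous _ _ _ _ 1) => x y; rewrite mul1r.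
    exact: (rnorm_hsum_ge2 (x - y)).
  move=> x x1; exists (abs_inv_pow D d (inr x)); last by rewrite TE.
  by apply: TK; rewrite ninr.
have cinl : continuous inl.
  apply: (@rlip_map_continuous _ _ _ _ 1) => x y; rewrite mul1r -ninl.
  by rewrite (_ : inl x - inl y = inl (x - y))//; congr pair; rewrite subr0.
have cinr : continuous inr.
  apply: (@rlip_map_continuous _ _ _ _ 1) => x y; rewrite mul1r -ninr.
  by rewrite (_ : inr x - inr y = inr (x - y))//; congr pair; rewrite subr0.
apply: (@compact_op_sub _ _ _ ((fun p : H1 * H2 => inl p.1 + inr p.2) @`
   (closure (abs_inv_pow D1 d @` [set x | `|x| <= 1]) `*`
    closure (abs_inv_pow D2 d @` [set x | `|x| <= 1])))); first by case: bT.
  apply: continuous_compact; last exact: compact_setX.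
  apply: continuous_subspaceT => p; apply: cvgD.
    by apply: continuous_comp; [exact: cvg_fst|exact: cinl].
  by apply: continuous_comp; [exact: cvg_snd|exact: cinr].
move=> x x1; exists (abs_inv_pow D1 d x.1, abs_inv_pow D2 d x.2).
  split=> /=; first by apply: TK1; rewrite (le_trans (rnorm_hsum_ge1 _)).
  by apply: TK2; rewrite (le_trans (rnorm_hsum_ge2 _)).
by rewrite TE; congr pair; rewrite /= ?addr0 ?add0r.
Qed.

End SumSpectrum.

(** [|D|^(-d')] is the bounded operator [|D|^(-(d' - d))] after the compact operator [|D|^(-d)]. *)
Lemma compact_abs_inv_pow_le (R : realType) (H : hilbertType R)
    (A : set (H -> H)) (D : unbounded_op H) (d d' : R) :
  spectral_triple A D -> 0 <= d -> d <= d' ->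
  compact_op (abs_inv_pow D d) -> compact_op (abs_inv_pow D d').
Proof.
move=> tD d0 dd'; have [e [l eD]] := triple_eigenbasis tD.
have d'0 := le_trans d0 dd'; have dd0 : 0 <= d' - d by rewrite subr_ge0.
have [b _] := abs_inv_powP tD eD d0; have [b' _] := abs_inv_powP tD eD d'0.
have [b2 _] := abs_inv_powP tD eD dd0; have [be _ _ l0 _] := eD.
have [lin [c [c0 nc]]] := iffLR (bounded_opP _) b.
have [lin2 [c2 [c20 nc2]]] := iffLR (bounded_opP _) b2.
have TE : abs_inv_pow D d' = abs_inv_pow D (d' - d) \o abs_inv_pow D d.
  apply: (bounded_ext be b') => [|n].
    apply/bounded_opP; split; first by move=> k u v /=; rewrite lin lin2.
    exists (c2 * c); split=> [|u /=]; first exact: mulr_ge0.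
    by rewrite (le_trans (nc2 _))// -mulrA ler_wpM2l.
  rewrite /= !(abs_inv_pow_basis tD eD)// (linearZE lin2).
  rewrite (abs_inv_pow_basis tD eD)//.
  rewrite scalerA -rmorphM/= -powRD; last by rewrite (gt_eqF (l0 n)) implybT.
  by congr ((_ `^ _)%:C *: _); ring.
move=> /compact_op_unit[cK TK]; rewrite TE.
apply: (@compact_op_sub _ _ _ (abs_inv_pow D (d' - d) @`
  closure (abs_inv_pow D d @` [set x | `|x| <= 1]))).
- by rewrite -TE; case: b'.
- apply: continuous_compact cK; apply: continuous_subspaceT.
  exact: (linear_bounded_continuous lin2 nc2).
- by move=> x x1; exists (abs_inv_pow D d x) => //; exact: TK.
Qed.

(** * The spectral dimension *)

Section StepIntegral.
Context {R : realType}.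
Variable p : nat -> R.
Hypothesis p0 : forall n, 0 <= p n.
Hypothesis pmono : {homo p : m n / (m <= n)%N >-> n <= m}.
Local Notation leb := (@lebesgue_measure R).
Local Notation step := (fun x : R => p (Num.truncn x)).

Let mstep (A : set R) : measurable A -> measurable_fun A step.
Proof.
by move=> mA; apply: nonincreasing_measurable => // x y xy; exact/pmono/le_truncn.
Qed.

(** An arbitrary right bound covers both the whole cells [[n, n + 1[] and the last, closed and
    possibly degenerate, cell [[n, t]]. *)
Let integral_cst_step (n : nat) (b : itv_bound R) :
  (BLeft n%:R <= b)%O -> (b <= BLeft n.+1%:R)%O ->
  (\int[leb]_(x in [set` Interval (BLeft (n%:R : R)) b]) (step x)%:E =
   (p n)%:E * leb [set` Interval (BLeft (n%:R : R)) b])%E.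
Proof.
move=> nb bn; rewrite -integral_cst//; apply: eq_integral => x; rewrite inE/= => xb.
congr (_%:E); congr p; apply: truncn_def; move: xb.
rewrite itv_boundlr/= => /andP[nx xb]; apply/andP; split.
  by move: nx; rewrite bnd_simp.
by have := le_trans xb bn; rewrite bnd_simp.
Qed.

Let integral_split (n : nat) (b : itv_bound R) : (BLeft n%:R <= b)%O ->
  (\int[leb]_(x in [set` Interval (BLeft (0%R : R)) b]) (step x)%:E =
   \int[leb]_(x in `[0%R, n%:R[) (step x)%:E +
   \int[leb]_(x in [set` Interval (BLeft (n%:R : R)) b]) (step x)%:E)%E.
Proof.
move=> nb; rewrite (@itv_bndbnd_setU _ _ _ (BLeft n%:R))//; last first.
  by rewrite bnd_simp ler0n.
rewrite ge0_integral_setU//.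
- by apply/measurable_EFinP; apply: mstep; apply: measurableU.
- by move=> x _; rewrite lee_fin p0.
- apply/disj_setPS => x [/=]; rewrite !itv_boundlr/= => /andP[_ xn] /andP[nx _].
  by move: (lt_le_trans xn nx); rewrite ltxx.
Qed.

Let integral_itv_nat n :
  (\int[leb]_(x in `[0%R, n%:R[) (step x)%:E = (\sum_(k < n) p k)%:E)%E.
Proof.
elim: n => [|n ih]; first by rewrite set_itvco0 integral_set0 big_ord0.
rewrite (@integral_split n) ?bnd_simp ?ler_nat// ih integral_cst_step//; last first.
  by rewrite bnd_simp ler_nat.
rewrite lebesgue_measure_itv/= lte_fin ltr_nat ltnSn -EFinB -EFinM -EFinD.
by rewrite big_ord_recr/= -[n.+1]addn1 natrD addrAC subrr add0r mulr1.
Qed.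

Lemma Rintegral_step (t : R) : 0 <= t ->
  (\int[leb]_(x in `[0%R, t]) step x)%R =
  \sum_(k < Num.truncn t) p k + p (Num.truncn t) * (t - (Num.truncn t)%:R).
Proof.
move=> t0; have /andP[nt tn] := truncn_itv t0; set n := Num.truncn t in nt tn *.
rewrite /Rintegral (@integral_split n) ?bnd_simp// integral_itv_nat.
rewrite integral_cst_step ?bnd_simp// lebesgue_measure_itv/= lte_fin.
(* For integer [t] the last cell is a single point, of measure zero. *)
have [nt'|tn'] := ltP n%:R t; first by rewrite -EFinB -EFinM -EFinD.
by rewrite (le_anti (introT andP (conj nt tn'))) subrr !mulr0 mule0 adde0 addr0.
Qed.

End StepIntegral.

Section SpectralDim.
Context {R : realType}.
Implicit Types (p : nat -> R) (f g : R -> R).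

Definition step_sum p (t : R) : R :=
  \sum_(k < Num.truncn t) p k + p (Num.truncn t) * (t - (Num.truncn t)%:R).

Let frac_ge0 (t : R) : 0 <= t -> 0 <= t - (Num.truncn t)%:R.
Proof. by move=> t0; rewrite subr_ge0 truncn_le. Qed.

Lemma step_sum_ge0 p t : (forall n, 0 <= p n) -> 0 <= t -> 0 <= step_sum p t.
Proof.
by move=> p0 t0; rewrite addr_ge0// ?sumr_ge0// mulr_ge0// frac_ge0.
Qed.

Lemma step_sum_le p q (C : R) t : (forall n, p n <= C * q n) -> 0 <= t ->
  step_sum p t <= C * step_sum q t.
Proof.
move=> pq t0; rewrite /step_sum [leRHS]mulrDr mulr_sumr lerD// ?ler_sum//.
by rewrite mulrA ler_wpM2r// frac_ge0.
Qed.

Lemma sum_half_le p m : \sum_(k < m.*2) p k./2 = 2 * \sum_(k < m) p k.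
Proof.
elim: m => [|m ih]; first by rewrite !big_ord0 mulr0.
rewrite doubleS !big_ord_recr/= ih doubleK uphalf_double mulrDr -addrA.
by congr (_ + _); rewrite mulr_natl mulr2n.
Qed.

(** Each value at [k./2] is taken for two indices, whence the factor 2. The last partial step is
    enlarged to a whole one, and [1 <= t] gives [n./2.+1 <= n], which keeps the halved sums within
    the first [n] terms. *)
Lemma step_sum_half_le p p1 p2 t : (forall n, 0 <= p1 n) -> (forall n, 0 <= p2 n) ->
  (forall n, 0 <= p n) -> (forall n, p n <= p1 n./2 + p2 n./2) -> 1 <= t ->
  step_sum p t <= 2 * (step_sum p1 t + step_sum p2 t).
Proof.
move=> p10 p20 p0 pp t1; have t0 : 0 <= t := le_trans ler01 t1.
set n := Num.truncn t; have n0 : (0 < n)%N by rewrite /n truncn_gt0.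
have up : step_sum p t <= \sum_(k < n.+1) p k.
  rewrite big_ord_recr/= lerD2l// -[leRHS]mulr1 ler_wpM2l//.
  by rewrite lerBlDl natr1 ltW// truncnS_gt.
have mono (q : nat -> R) a b : (forall n, 0 <= q n) -> (a <= b)%N ->
    \sum_(k < a) q k <= \sum_(k < b) q k.
  move=> q0 ab; rewrite -(subnKC ab) big_split_ord/= lerDl.
  exact: sumr_ge0.
have low (q : nat -> R) : (forall n, 0 <= q n) ->
    \sum_(k < n.+1) q k./2 <= 2 * step_sum q t.
  move=> q0; rewrite (le_trans (mono (fun k => q k./2) _ (n./2.+1).*2 _ _))//.
    by rewrite doubleS ltnS -[leqLHS]odd_double_half; case: odd.
  rewrite sum_half_le ler_pM2l// (le_trans (mono q _ n _ _))//.
    by rewrite -divn2 ltn_Pdiv.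
  by rewrite lerDl mulr_ge0// frac_ge0.
rewrite (le_trans up)// mulrDr (le_trans _ (lerD (low _ p10) (low _ p20)))//.
by rewrite -big_split/= ler_sum.
Qed.

Lemma ratio_cvg0 f g (C : R) :
  (forall t, 1 <= t -> 0 <= f t <= C * g t) ->
  (g t / ln t) @[t --> +oo] --> 0 -> (f t / ln t) @[t --> +oo] --> 0.
Proof.
move=> fg g0; apply: (@squeeze_cvgr _ _ _ _ (cst 0) (fun t => C * (g t / ln t))).
- near=> t; have t1 : 1 < t by near: t; exact: nbhs_pinfty_gt.
  have /andP[f0 fC] := fg _ (ltW t1); have lt0 := ln_gt0 t1.
  by rewrite divr_ge0 ?(ltW lt0)//= mulrA ler_pM2r// invr_gt0.
- exact: cvg_cst.
- by rewrite -[X in _ --> X](mulr0 C); apply: cvgM => //; exact: cvg_cst.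
Unshelve. all: by end_near. Qed.

Section OneTriple.
Context {H : hilbertType R} (A : set (H -> H)) (D : unbounded_op H).
Hypothesis tD : spectral_triple A D.
Variables (e : nat -> H) (l : nat -> R).
Hypothesis eD : eigenbasis D e l.

Lemma S_upE (d t : R) : 0 <= d -> 0 <= t ->
  S_up (abs_inv_pow D d) t = step_sum (fun n => `|l n| `^ (- d)) t.
Proof.
move=> d0 t0; rewrite /S_up /mu_fun (singular_value_abs_inv_pow tD eD d0).
rewrite (@Rintegral_step _ (fun n => `|l n| `^ (- d)))// => m n mn.
exact: (eigenvalue_powRN_le eD).
Qed.

(** Admissible exponents are closed upwards, so the larger of two exponents serves both summands.
    The constant is the largest eigenvalue of [|D|^(-(d' - d))]. *)
Lemma L1oo0_abs_inv_pow_le (d d' : R) : 0 <= d -> d <= d' ->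
  L1oo0 (abs_inv_pow D d) -> L1oo0 (abs_inv_pow D d').
Proof.
move=> d0 dd' [cD Sd]; split; first exact: (compact_abs_inv_pow_le tD d0 dd').
have d'0 := le_trans d0 dd'; have [_ _ _ l0 _] := eD.
apply: (ratio_cvg0 (C := `|l 0%N| `^ (- (d' - d)))) Sd => t t1.
have t0 : 0 <= t := le_trans ler01 t1.
rewrite !S_upE// step_sum_ge0//=.
apply: step_sum_le => // n.
have -> : `|l n| `^ (- d') = `|l n| `^ (- (d' - d)) * `|l n| `^ (- d).
  rewrite -powRD; last by rewrite (gt_eqF (l0 n)) implybT.
  by congr (_ `^ _); ring.
by rewrite ler_wpM2r ?powR_ge0// (eigenvalue_powRN_le eD)// subr_ge0.
Qed.

End OneTriple.

End SpectralDim.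

Section SpectralDimSum.
Context {R : realType} {H1 H2 : hilbertType R}.
Variables (A1 : set (H1 -> H1)) (D1 : unbounded_op H1).
Variables (A2 : set (H2 -> H2)) (D2 : unbounded_op H2).
Variables (A : set (hsum H1 H2 -> hsum H1 H2)).
Local Notation D := (opsum D1 D2).
Hypothesis t1 : spectral_triple A1 D1.
Hypothesis t2 : spectral_triple A2 D2.
Hypothesis tD : spectral_triple A D.

Lemma L1oo0_opsum (d : R) : 0 < d -> L1oo0 (abs_inv_pow D d) <->
  L1oo0 (abs_inv_pow D1 d) /\ L1oo0 (abs_inv_pow D2 d).
Proof.
move=> d0; have d0' := ltW d0; have [e1 [l1 eD1]] := triple_eigenbasis t1.
have [e2 [l2 eD2]] := triple_eigenbasis t2; have [e [l eD]] := triple_eigenbasis tD.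
have cE := compact_abs_inv_pow_opsum t1 t2 tD eD1 eD2 eD d0'.
have [_ _ _ l0 _] := eD; have [_ _ _ l10 _] := eD1; have [_ _ _ l20 _] := eD2.
have powN (a b : R) : 0 < a -> a <= b -> b `^ (- d) <= a `^ (- d).
  move=> a0 ab; have b0 := lt_le_trans a0 ab.
  by rewrite !powRN lef_pV2 ?posrE ?powR_gt0// ge0_ler_powR ?nnegrE// ltW.
split=> [[/cE[c1 c2] S]|[[c1 S1] [c2 S2]]].
  split; split=> //; apply: (ratio_cvg0 (C := 1)) S => t t1'.
    have t0 : 0 <= t := le_trans ler01 t1'.
    rewrite (S_upE t1 eD1)// (S_upE tD eD)// step_sum_ge0//=.
    apply: step_sum_le => // n.
    by rewrite mul1r powN// (opsum_eigenvalue_le1 tD eD1 eD).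
  have t0 : 0 <= t := le_trans ler01 t1'.
  rewrite (S_upE t2 eD2)// (S_upE tD eD)// step_sum_ge0//=.
  apply: step_sum_le => // n.
  by rewrite mul1r powN// (opsum_eigenvalue_le2 tD eD2 eD).
split; first exact/cE.
apply: (ratio_cvg0 (C := 2)
    (g := fun t => S_up (abs_inv_pow D1 d) t + S_up (abs_inv_pow D2 d) t)).
  move=> t t1'; have t0 : 0 <= t := le_trans ler01 t1'.
  rewrite (S_upE t1 eD1)// (S_upE t2 eD2)// (S_upE tD eD)//.
  rewrite step_sum_ge0//=.
  apply: step_sum_half_le => // n; try exact: powR_ge0.
  (* A negative power turns the minimum into a maximum, which is at most the sum of the two
     terms. *)
  have := opsum_eigenvalue_ge t1 t2 eD1 eD2 eD n.
  rewrite ge_min => /orP[ln|ln].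
    by rewrite (le_trans (powN _ _ (l10 _) ln))// lerDl powR_ge0.
  by rewrite (le_trans (powN _ _ (l20 _) ln))// lerDr powR_ge0.
rewrite -[X in _ --> X]addr0; under eq_fun do rewrite mulrDl.
exact: cvgD.
Qed.

(** The admissible exponents of the sum form the intersection of two upward closed sets, whose
    infimum is the larger of the two infima. *)
Lemma spectral_dim_opsum :
  spectral_dim D = Order.max (spectral_dim D1) (spectral_dim D2).
Proof.
have [e1 [l1 eD1]] := triple_eigenbasis t1.
have [e2 [l2 eD2]] := triple_eigenbasis t2.
apply/eqP; rewrite eq_le; apply/andP; split; last first.
  rewrite ge_max; apply/andP; split; apply: ereal_inf_le_tmp =>
    _ [d [d0 /(L1oo0_opsum d0)[? ?]] <-]; by exists d.
rewrite leNgt gt_max; apply/negP => /andP[/ereal_inf_lt[_ [d1 [d10 Ld1] <-] d1D]].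
move=> /ereal_inf_lt[_ [d2 [d20 Ld2] <-] d2D].
have : (spectral_dim D <= (Order.max d1 d2)%:E)%E.
  apply: ereal_inf_lbound; exists (Order.max d1 d2) => //.
  have m0 : 0 < Order.max d1 d2 by rewrite lt_max d10.
  split=> //; apply/(L1oo0_opsum m0); split.
    by apply: (L1oo0_abs_inv_pow_le t1 eD1 (ltW d10)) Ld1; rewrite le_max lexx.
  by apply: (L1oo0_abs_inv_pow_le t2 eD2 (ltW d20)) Ld2; rewrite le_max lexx orbT.
by apply/negP; rewrite -ltNge EFin_max gt_max d1D.
Qed.

End SpectralDimSum.

(** * Minimal and maximal dimensions *)

Section EReal.
Context {R : realType}.
Implicit Types (g : R -> \bar R) (a b L : \bar R).

Lemma ereal_lt_between a b : (a < b)%E ->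
  exists2 x : R, (a < x%:E)%E & (x%:E < b)%E.
Proof.
case: a b => [a||] [b||]//=; rewrite ?lte_fin => ab.
- by exists ((a + b) / 2); rewrite lte_fin; lra.
- by exists (a + 1); rewrite ?lte_fin ?ltry//; lra.
- by exists (b - 1); rewrite ?lte_fin ?ltNyr//; lra.
- by exists 0; rewrite ?ltry ?ltNyr.
Qed.

Lemma near_pinfty_ex (P : R -> Prop) : (\forall x \near +oo, P x) ->
  exists2 x, 0 < x & P x.
Proof.
move=> [M [_ MP]]; exists (`|M| + 1); first by rewrite ltr_wpDl.
by apply: MP; rewrite (le_lt_trans (ler_norm M))// ltrDl.
Qed.

(** Strict comparison with real numbers treats finite and infinite limits alike. *)
Lemma ereal_cvgP g L :
  (forall x : R, (L < x%:E)%E -> \forall h \near +oo, (g h < x%:E)%E) ->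
  (forall x : R, (x%:E < L)%E -> \forall h \near +oo, (x%:E < g h)%E) ->
  g h @[h --> +oo] --> L.
Proof.
case: L => [r||] gu gl.
- have near_r (d : R) : 0 < d ->
      \forall h \near +oo, ((r - d)%:E < g h)%E /\ (g h < (r + d)%:E)%E.
    move=> d0; near=> h; split; near: h.
      by apply: gl; rewrite lte_fin ltrBlDr ltrDl.
    by apply: gu; rewrite lte_fin ltrDl.
  apply/fine_cvgP; split.
    by apply: filterS (near_r 1 ltr01) => h; case: (g h) => [x||] [].
  apply/cvgrPdist_lt => d d0; apply: filterS (near_r d d0) => h /=.
  by case: (g h) => [x||] []//=; rewrite !lte_fin ltr_distlC => -> ->.
- by apply/cvgeyPgt => x; apply: gl; rewrite ltry.
- by apply/cvgeNyPlt => x; apply: gu; rewrite ltNyr.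
Unshelve. all: by end_near. Qed.

Lemma limf_esup_le g L : (\forall t \near +oo, (g t <= L)%E) ->
  (limf_esup g (pinfty_nbhs R) <= L)%E.
Proof.
move=> gL; apply: (le_trans (y := ereal_sup (g @` [set t | (g t <= L)%E]))).
  by apply: ereal_inf_lbound; exists [set t | (g t <= L)%E].
by apply: ge_ereal_sup => _ [t tL <-].
Qed.

Lemma limf_esup_lt g L : (limf_esup g (pinfty_nbhs R) < L)%E ->
  \forall t \near +oo, (g t < L)%E.
Proof.
move=> /ereal_inf_lt[_ [V FV <-] VL]; apply: filterS FV => t Vt.
by apply: le_lt_trans VL; apply: ereal_sup_ubound; exists t.
Qed.

Lemma limf_einf_ge g L : (\forall t \near +oo, (L <= g t)%E) ->
  (L <= limf_einf g (pinfty_nbhs R))%E.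
Proof.
move=> gL; rewrite /limf_einf leeNr; apply: limf_esup_le.
by apply: filterS gL => t; rewrite leeN2.
Qed.

Lemma limf_einf_gt g L : (L < limf_einf g (pinfty_nbhs R))%E ->
  \forall t \near +oo, (L < g t)%E.
Proof.
rewrite /limf_einf lteNr => /limf_esup_lt.
by apply: filterS => t; rewrite lteN2.
Qed.

End EReal.

(** * Asymptotic slopes of a monotone function *)

Section Growth.
Context {R : realType}.
Variable f : R -> R.
Hypothesis fmono : {homo f : x y / x <= y}.
Implicit Types (t s h x : R).

Definition diff_quot h t : \bar R := ((f (t + h) - f t) / h)%:E.

Definition upper_slope h := limf_esup (diff_quot h) (pinfty_nbhs R).

Definition lower_slope h := limf_einf (diff_quot h) (pinfty_nbhs R).

Definition slope_le x := exists C t0, forall t s, t0 <= t -> 0 <= s ->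
  f (t + s) - f t <= x * s + C.

Definition slope_ge x := exists C t0, forall t s, t0 <= t -> 0 <= s ->
  x * s - C <= f (t + s) - f t.

Let step_le x h t0 : 0 < h ->
  (forall t, t0 < t -> f (t + h) - f t <= x * h) ->
  forall n t, t0 < t -> f (t + n%:R * h) - f t <= n%:R * (x * h).
Proof.
move=> h0 fh; elim=> [|n ih] t tt; first by rewrite !mul0r addr0 subrr.
have := fh (t + n%:R * h); rewrite (lt_le_trans tt) ?lerDl ?mulr_ge0 ?(ltW h0)//.
move=> /(_ isT); have := ih t tt; rewrite -natr1 !mulrDl !mul1r addrA.
by lra.
Qed.

Let step_ge x h t0 : 0 < h ->
  (forall t, t0 < t -> x * h <= f (t + h) - f t) ->
  forall n t, t0 < t -> n%:R * (x * h) <= f (t + n%:R * h) - f t.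
Proof.
move=> h0 fh; elim=> [|n ih] t tt; first by rewrite !mul0r addr0 subrr.
have := fh (t + n%:R * h); rewrite (lt_le_trans tt) ?lerDl ?mulr_ge0 ?(ltW h0)//.
move=> /(_ isT); have := ih t tt; rewrite -natr1 !mulrDl !mul1r addrA.
by lra.
Qed.

(** The bound is iterated over steps of length [h]. Rounding [s] up to a multiple of [h] only
    increases the increment, by monotonicity, and the overshoot of at most [h] costs [|x| h]. *)
Lemma slope_leP x h : 0 < h -> (upper_slope h < x%:E)%E -> slope_le x.
Proof.
move=> h0 /limf_esup_lt[t0 [_ t0P]].
have fh t : t0 < t -> f (t + h) - f t <= x * h.
  by move=> /t0P; rewrite lte_fin ltr_pdivrMr// => /ltW.
exists (`|x| * h), (t0 + 1) => t s tt s0; have tt' : t0 < t by lra.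
pose n := (Num.truncn (s / h)).+1.
have sh0 : 0 <= s / h by rewrite divr_ge0// ltW.
have /andP[ns sn] := truncn_itv sh0.
have sn' : s <= n%:R * h by rewrite -ler_pdivrMr// ltW.
have ns' : n%:R * h - s <= h.
  by move: ns; rewrite ler_pdivlMr// -natr1 mulrDl mul1r; lra.
have := step_le h0 fh n tt'; have : f (t + s) <= f (t + n%:R * h).
  by rewrite fmono// lerD2l.
have : x * (n%:R * h - s) <= `|x| * h.
  rewrite (le_trans (ler_norm _))// normrM ler_wpM2l// ger0_norm//.
  by rewrite subr_ge0.
by lra.
Qed.

(** Here [s] is rounded down, which by monotonicity can only lower the increment. *)
Lemma slope_geP x h : 0 < h -> (x%:E < lower_slope h)%E -> slope_ge x.
Proof.
move=> h0 /limf_einf_gt[t0 [_ t0P]].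
have fh t : t0 < t -> x * h <= f (t + h) - f t.
  by move=> /t0P; rewrite lte_fin ltr_pdivlMr// => /ltW.
exists (`|x| * h), (t0 + 1) => t s tt s0; have tt' : t0 < t by lra.
pose n := Num.truncn (s / h).
have sh0 : 0 <= s / h by rewrite divr_ge0// ltW.
have /andP[ns sn] := truncn_itv sh0.
have ns' : n%:R * h <= s by rewrite -ler_pdivlMr.
have sn' : s - n%:R * h <= h.
  by move: sn; rewrite ltr_pdivrMr// -natr1 mulrDl mul1r => /ltW; lra.
have := step_ge h0 fh n tt'; have : f (t + n%:R * h) <= f (t + s).
  by rewrite fmono// lerD2l.
have : x * (s - n%:R * h) <= `|x| * h.
  rewrite (le_trans (ler_norm _))// normrM ler_wpM2l// ger0_norm//.
  by rewrite subr_ge0.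
by lra.
Qed.

(** The quotient is at most [x + C / h], which is below [y] as soon as [h > |C| / (y - x)]. *)
Lemma upper_slope_le x y : slope_le x -> x < y ->
  \forall h \near +oo, (upper_slope h < y%:E)%E.
Proof.
move=> [C [t0 fC]] xy; near=> h.
have h0 : 0 < h by near: h; exact: nbhs_pinfty_gt.
have hC : `|C| / (y - x) < h by near: h; apply: nbhs_pinfty_gt; exact: num_real.
apply: (@le_lt_trans _ _ (x + C / h)%:E).
  apply: limf_esup_le; near=> t; rewrite lee_fin ler_pdivrMr// mulrDl.
  rewrite -mulrA mulVf ?mulr1 ?gt_eqF//; apply: fC; last exact: ltW.
  by near: t; apply: nbhs_pinfty_ge; exact: num_real.
rewrite lte_fin -ltrBrDl ltr_pdivrMr//.
move: hC; rewrite ltr_pdivrMr ?subr_gt0// mulrC; apply: le_lt_trans.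
exact: ler_norm.
Unshelve. all: by end_near. Qed.

Lemma lower_slope_ge x y : slope_ge x -> y < x ->
  \forall h \near +oo, (y%:E < lower_slope h)%E.
Proof.
move=> [C [t0 fC]] xy; near=> h.
have h0 : 0 < h by near: h; exact: nbhs_pinfty_gt.
have hC : `|C| / (x - y) < h by near: h; apply: nbhs_pinfty_gt; exact: num_real.
apply: (@lt_le_trans _ _ (x - C / h)%:E).
  rewrite lte_fin ltrBrDl -ltrBrDr ltr_pdivrMr//.
  move: hC; rewrite ltr_pdivrMr ?subr_gt0// mulrC; apply: le_lt_trans.
  exact: ler_norm.
apply: limf_einf_ge; near=> t; rewrite lee_fin ler_pdivlMr// mulrBl.
rewrite -mulrA mulVf ?mulr1 ?gt_eqF//; apply: fC; last exact: ltW.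
by near: t; apply: nbhs_pinfty_ge; exact: num_real.
Unshelve. all: by end_near. Qed.

Lemma diff_quot_ge0 h t : 0 < h -> (0 <= diff_quot h t)%E.
Proof.
by move=> h0; rewrite lee_fin divr_ge0 ?(ltW h0)// subr_ge0 fmono// lerDl ltW.
Qed.

(* [h * upper_slope h] is subadditive (possibly infinite), so the limit is the
   infimum, as in Fekete's lemma. *)
Lemma upper_slope_lim : exists L, [/\ upper_slope h @[h --> +oo] --> L, (0 <= L)%E,
  forall x, (L < x%:E)%E -> slope_le x & forall x, slope_le x -> (L <= x%:E)%E].
Proof.
pose L := ereal_inf [set upper_slope h | h in [set h | 0 < h]].
have inf_le h : 0 < h -> (L <= upper_slope h)%E.
  by move=> h0; apply: ereal_inf_lbound; exists h.
have L1 x : (L < x%:E)%E -> slope_le x.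
  by move=> /ereal_inf_lt[_ [h h0 <-]]; exact: slope_leP.
exists L; split=> //.
- apply: ereal_cvgP => x.
    move=> /ereal_lt_between[y /L1 Ly yx]; apply: upper_slope_le Ly _.
    by rewrite -lte_fin.
  move=> xL; near=> h; apply: (lt_le_trans xL); apply: inf_le.
  by near: h; exact: nbhs_pinfty_gt.
- apply: le_ereal_inf_tmp => _ [h h0 <-]; apply: limf_esup_ge0.
    by move=> [M [_ /(_ (M + 1))]]; apply; rewrite ltrDl.
  by move=> t; exact: diff_quot_ge0.
- move=> x sx; rewrite leNgt; apply/negP => /ereal_lt_between[y xy yL].
  have [h h0 hy] := near_pinfty_ex (upper_slope_le sx (xy : x < y)).
  by have := lt_trans yL (le_lt_trans (inf_le h h0) hy); rewrite ltxx.
Unshelve. all: by end_near. Qed.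

(** Dually, [h * lower_slope h] is superadditive and the limit is the supremum. *)
Lemma lower_slope_lim : exists L, [/\ lower_slope h @[h --> +oo] --> L, (0 <= L)%E,
  forall x, (x%:E < L)%E -> slope_ge x & forall x, slope_ge x -> (x%:E <= L)%E].
Proof.
pose L := ereal_sup [set lower_slope h | h in [set h | 0 < h]].
have sup_ge h : 0 < h -> (lower_slope h <= L)%E.
  by move=> h0; apply: ereal_sup_ubound; exists h.
have L1 x : (x%:E < L)%E -> slope_ge x.
  by move=> /ereal_sup_gt[_ [h h0 <-]]; exact: slope_geP.
exists L; split=> //.
- apply: ereal_cvgP => x.
    move=> xL; near=> h; apply: le_lt_trans xL; apply: sup_ge.
    by near: h; exact: nbhs_pinfty_gt.
  move=> /ereal_lt_between[y xy /L1 Ly]; apply: lower_slope_ge Ly _.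
  by rewrite -lte_fin.
- apply: le_trans (sup_ge 1 ltr01); apply: limf_einf_ge.
  by apply: nearW => t; exact: diff_quot_ge0.
- move=> x sx; rewrite leNgt; apply/negP => /ereal_lt_between[y Ly yx].
  have [h h0 hy] := near_pinfty_ex (lower_slope_ge sx (yx : y < x)).
  by have := lt_trans (lt_le_trans hy (sup_ge h h0)) Ly; rewrite ltxx.
Unshelve. all: by end_near. Qed.

End Growth.

(** * Slope bounds under the shifted minimum *)

Section Merge.
Context {R : realType}.
Variables (f f1 f2 : R -> R) (k t0 : R).
Hypothesis fmono : {homo f : x y / x <= y}.
Hypothesis k0 : 0 <= k.
Hypothesis f_le : forall t, f t <= Num.min (f1 t) (f2 t).
Hypothesis f_ge : forall t, t0 <= t -> Num.min (f1 (t - k)) (f2 (t - k)) <= f t.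

(** Pick [i] realising the minimum at [t - k]: since [f] is below both functions at [t + s], the
    increment of [f] is at most that of [f i] over length [s + k], whence the extra [x k]. *)
Lemma slope_le_merge x : slope_le f1 x -> slope_le f2 x -> slope_le f x.
Proof.
move=> [C1 [t1 P1]] [C2 [t2 P2]].
exists (x * k + Num.max C1 C2), (Num.max t0 (Num.max (t1 + k) (t2 + k))) => t s.
rewrite !ge_max => /andP[tt0 /andP[tt1 tt2]] s0.
have := f_ge tt0; have := f_le (t + s).
have [CC1 CC2] : C1 <= Num.max C1 C2 /\ C2 <= Num.max C1 C2.
  by rewrite !le_max !lexx orbT.
have sk0 : 0 <= s + k by rewrite addr_ge0.
have tE : t - k + (s + k) = t + s by ring.
rewrite le_min => /andP[fs1 fs2]; rewrite ge_min => /orP[fk|fk].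
  have := P1 (t - k) (s + k); rewrite lerBrDr tE mulrDr => /(_ tt1 sk0); lra.
have := P2 (t - k) (s + k); rewrite lerBrDr tE mulrDr => /(_ tt2 sk0); lra.
Qed.

(** Now [i] realises the minimum at [t + s - k], and the comparison is over length [s - k]. When
    [s < k] monotonicity of [f] suffices, as [x s] is then at most [|x| k]. *)
Lemma slope_ge_merge x : slope_ge f1 x -> slope_ge f2 x -> slope_ge f x.
Proof.
move=> [C1 [t1 P1]] [C2 [t2 P2]].
exists (`|x| * k + `|C1| + `|C2|), (Num.max t0 (Num.max t1 t2)) => t s.
rewrite !ge_max => /andP[tt0 /andP[tt1 tt2]] s0.
have [C10 C20] := (normr_ge0 C1, normr_ge0 C2).
have [CC1 CC2] := (ler_norm C1, ler_norm C2).
have [sk|ks] := ltP s k.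
  have : f t <= f (t + s) by rewrite fmono// lerDl.
  have : x * s <= `|x| * k.
    rewrite (le_trans (ler_norm _))// normrM ler_wpM2l// ger0_norm// ltW//.
  by lra.
have := f_le t; have sk0 : 0 <= s - k by rewrite subr_ge0.
have xk : x * k <= `|x| * k by rewrite ler_wpM2r// ler_norm.
have tts : t0 <= t + s by rewrite (le_trans tt0)// lerDl.
have tE : t + s - k = t + (s - k) by ring.
rewrite le_min => /andP[fs1 fs2].
have := f_ge tts; rewrite tE ge_min => /orP[fk|fk].
  by have := P1 t (s - k) tt1 sk0; rewrite mulrBr; lra.
by have := P2 t (s - k) tt2 sk0; rewrite mulrBr; lra.
Qed.

End Merge.

Section DimensionInterval.
Context {R : realType} {H1 H2 : hilbertType R}.
Variables (A1 : set (H1 -> H1)) (D1 : unbounded_op H1).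
Variables (A2 : set (H2 -> H2)) (D2 : unbounded_op H2).
Variables (A : set (hsum H1 H2 -> hsum H1 H2)).
Local Notation D := (opsum D1 D2).
Hypothesis t1 : spectral_triple A1 D1.
Hypothesis t2 : spectral_triple A2 D2.
Hypothesis tD : spectral_triple A D.

Lemma log_muE (H : hilbertType R) (B : set (H -> H)) (E : unbounded_op H)
    (e : nat -> H) (l : nat -> R) : spectral_triple B E -> eigenbasis E e l ->
  log_mu E = fun t => ln `|l (Num.truncn (expR t))|.
Proof.
move=> tE eE; apply/funext => t; have [_ _ _ l0 _] := eE.
rewrite /log_mu /mu_fun (singular_value_abs_inv_pow tE eE)//.
by rewrite ln_powR mulN1r opprK.
Qed.

Lemma log_mu_mono (H : hilbertType R) (B : set (H -> H)) (E : unbounded_op H) :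
  spectral_triple B E -> {homo log_mu E : x y / x <= y}.
Proof.
move=> tE x y xy; have [e [l eE]] := triple_eigenbasis tE.
have [_ _ _ l0 lmono] := eE.
rewrite (log_muE tE eE) ler_ln ?posrE// lmono// le_truncn//.
by rewrite ler_expR.
Qed.

Lemma log_mu_opsum_le t :
  log_mu D t <= Num.min (log_mu D1 t) (log_mu D2 t).
Proof.
have [e1 [l1 eD1]] := triple_eigenbasis t1.
have [e2 [l2 eD2]] := triple_eigenbasis t2.
have [e [l eD]] := triple_eigenbasis tD.
have [_ _ _ l0 _] := eD; have [_ _ _ l10 _] := eD1; have [_ _ _ l20 _] := eD2.
rewrite (log_muE t1 eD1) (log_muE t2 eD2) (log_muE tD eD) le_min.
rewrite !ler_ln ?posrE// (opsum_eigenvalue_le1 tD eD1 eD).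
by rewrite (opsum_eigenvalue_le2 tD eD2 eD).
Qed.

(** Halving the index is dividing [exp t] by 2, that is shifting [t] by [ln 2]; the integer parts go
    the right way because [truncn (exp t / 2) <= (truncn (exp t))./2]. *)
Lemma log_mu_opsum_ge t :
  Num.min (log_mu D1 (t - ln 2)) (log_mu D2 (t - ln 2)) <= log_mu D t.
Proof.
have [e1 [l1 eD1]] := triple_eigenbasis t1.
have [e2 [l2 eD2]] := triple_eigenbasis t2.
have [e [l eD]] := triple_eigenbasis tD.
have [_ _ _ l0 _] := eD; have [_ _ _ l10 lmono1] := eD1.
have [_ _ _ l20 lmono2] := eD2.
rewrite (log_muE t1 eD1) (log_muE t2 eD2) (log_muE tD eD) ge_min.
rewrite !ler_ln ?posrE// expRB lnK ?posrE//.
have half : (Num.truncn (expR t / 2) <= (Num.truncn (expR t))./2)%N.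
  have e0 : 0 <= expR t := expR_ge0 t.
  have h0 : 0 <= expR t / 2 by rewrite divr_ge0.
  rewrite -divn2 leq_divRL// truncn_ge_nat// natrM -ler_pdivlMr//.
  by rewrite truncn_le.
have := opsum_eigenvalue_ge t1 t2 eD1 eD2 eD (Num.truncn (expR t)).
rewrite ge_min => /orP[h|h]; apply/orP; [left|right]; apply: le_trans h.
  exact: lmono1.
exact: lmono2.
Qed.

(** Isolates all that the comparison of dimensions uses: a limit determined by slope bounds, and its
    nonnegativity, which makes inversion in [\bar R] order reversing, with [0] and infinity
    exchanged. *)
Lemma slope_dim (H : hilbertType R) (B : set (H -> H)) (E : unbounded_op H) :
  spectral_triple B E ->
  ((exists L, [/\ min_dim E = L^-1, 0 <= L,
    forall x, L < x%:E -> slope_le (log_mu E) x &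
    forall x, slope_le (log_mu E) x -> L <= x%:E]) /\
  exists L, [/\ max_dim E = L^-1, 0 <= L,
    forall x, x%:E < L -> slope_ge (log_mu E) x &
    forall x, slope_ge (log_mu E) x -> x%:E <= L])%E.
Proof.
move=> tE; have fm := log_mu_mono tE.
have [L [cL L0 L1 L2]] := upper_slope_lim fm.
have [M [cM M0 M1 M2]] := lower_slope_lim fm.
split; [exists L|exists M]; split=> //.
  by rewrite /min_dim; congr (_^-1)%E; apply/cvg_lim.
by rewrite /max_dim; congr (_^-1)%E; apply/cvg_lim.
Qed.

(** After inversion the claim is [L <= max L1 L2]. A real [x] strictly between [max L1 L2] and [L]
    would bound the slopes of both summands, hence those of the sum. *)
Lemma min_dim_opsum : (Order.min (min_dim D1) (min_dim D2) <= min_dim D)%E.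
Proof.
have [[L1 [-> L10 L1l _]] _] := slope_dim t1.
have [[L2 [-> L20 L2l _]] _] := slope_dim t2.
have [[L [-> L0 _ Lg]] _] := slope_dim tD.
suff : (L <= Order.max L1 L2)%E.
  rewrite le_max => /orP[LL|LL]; rewrite ge_min; apply/orP; [left|right];
    by rewrite lee_pV2// inE.
rewrite leNgt; apply/negP => /ereal_lt_between[x]; rewrite gt_max => /andP[x1 x2].
rewrite ltNge => /negP; apply; apply: Lg.
have ln20 : 0 <= ln 2 :> R by rewrite ln_ge0// ler1n.
exact: (slope_le_merge (t0 := 0) ln20 log_mu_opsum_le
  (fun t _ => log_mu_opsum_ge t) (L1l x x1) (L2l x x2)).
Qed.

Lemma max_dim_opsum : (max_dim D <= Order.max (max_dim D1) (max_dim D2))%E.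
Proof.
have [_ [L1 [-> L10 L1l _]]] := slope_dim t1.
have [_ [L2 [-> L20 L2l _]]] := slope_dim t2.
have [_ [L [-> L0 _ Lg]]] := slope_dim tD.
suff : (Order.min L1 L2 <= L)%E.
  rewrite ge_min => /orP[LL|LL]; rewrite le_max; apply/orP; [left|right];
    by rewrite lee_pV2// inE.
rewrite leNgt; apply/negP => /ereal_lt_between[x Lx].
rewrite lt_min => /andP[x1 x2].
move: Lx; rewrite ltNge => /negP; apply; apply: Lg.
have ln20 : 0 <= ln 2 :> R by rewrite ln_ge0// ler1n.
exact: (slope_ge_merge (t0 := 0) (log_mu_mono tD) ln20 log_mu_opsum_le
  (fun t _ => log_mu_opsum_ge t) (L1l x x1) (L2l x x2)).
Qed.

End DimensionInterval.

Theorem corollary2p10 (R : realType) (H1 H2 : hilbertType R)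
    (A1 : set (H1 -> H1)) (D1 : unbounded_op H1)
    (A2 : set (H2 -> H2)) (D2 : unbounded_op H2)
    (A : set (hsum H1 H2 -> hsum H1 H2)) :
  spectral_triple A1 D1 -> spectral_triple A2 D2 ->
  spectral_triple A (opsum D1 D2) ->
  spectral_dim (opsum D1 D2) = Order.max (spectral_dim D1) (spectral_dim D2) /\
  `[min_dim (opsum D1 D2), max_dim (opsum D1 D2)] `<=`
  `[Order.min (min_dim D1) (min_dim D2), Order.max (max_dim D1) (max_dim D2)].
Proof.
move=> t1 t2 tD; split; first exact: (spectral_dim_opsum t1 t2 tD).
move=> x; rewrite /= !in_itv/= => /andP[mx xM].
rewrite (le_trans (min_dim_opsum t1 t2 tD))//=.
exact: le_trans (max_dim_opsum t1 t2 tD).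
Qed.
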